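(* Let $T\ge 1$ be an integer, let $\mathcal{X}_1,\dots,\mathcal{X}_T$ be Polish spaces and $\mathcal{X}=\prod_{t=1}^T\mathcal{X}_t$. Let $\mu,\nu\in\mathcal{P}(\mathcal{X})$ and let $\varphi:\mathcal{X}\to[0,\infty)$ be a Borel measurable function. Then $$\mathrm{ATV}_{\varphi}(\mu,\nu)\le (2\sqrt{T}+1)\left(1+\log\int_{\mathcal{X}}e^{\varphi(x)^2}\,\mu(dx)\right)^{1/2}\sqrt{2H(\nu\,|\,\mu)}.$$
   Context: $\mathcal{P}(\mathcal{X})$ is the set of Borel probability measures on $\mathcal{X}$, where $\mathcal{X}=\prod_{t=1}^T\mathcal{X}_t$ carries the product topology; elements are written $x=(x_1,\dots,x_T)$. Relative entropy: $H(\nu\,|\,\mu)=\int_{\mathcal{X}}\log\left(\frac{d\nu}{d\mu}\right)d\nu$ if $\nu\ll\mu$, and $H(\nu\,|\,\mu)=+\infty$ otherwise. $\mathrm{Cpl}(\mu,\nu)$ is the set of couplings of $\mu$ and $\nu$, i.e. Borel probability measures on $\mathcal{X}\times\mathcal{X}$ with marginals $\mu$ and $\nu$. A coupling $\pi\in\mathrm{Cpl}(\mu,\nu)$ is bicausal if for $(X,Y)\sim\pi$ (with $X=(X_1,\dots,X_T)$, $Y=(Y_1,\dots,Y_T)$) and every $t\in\{1,\dots,T-1\}$: under $\pi$, $(Y_1,\dots,Y_t)$ is conditionally independent of $X$ given $(X_1,\dots,X_t)$, and $(X_1,\dots,X_t)$ is conditionally independent of $Y$ given $(Y_1,\dots,Y_t)$.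 The set of bicausal couplings is denoted $\mathrm{Cpl}_{bc}(\mu,\nu)$. Adapted weighted total variation: $$\mathrm{ATV}_{\varphi}(\mu,\nu)=\inf_{\pi\in\mathrm{Cpl}_{bc}(\mu,\nu)}\int_{\mathcal{X}\times\mathcal{X}}(\varphi(x)+\varphi(y))\mathbf{1}_{\{x\ne y\}}\,\pi(dx,dy).$$ All quantities take values in $[0,\infty]$, with $\log\infty=\infty$ and $0\cdot\infty=0$. *)

(* Defs.v *)
From HB Require Import structures.
From mathcomp Require Import all_boot all_order all_algebra.
From mathcomp Require Import all_classical all_reals all_analysis.

Set Implicit Arguments.
Unset Strict Implicit.
Unset Printing Implicit Defensive.

Import Order.TTheory GRing.Theory Num.Theory.
Import numFieldNormedType.Exports.

Local Open Scope classical_set_scope.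
Local Open Scope ring_scope.

Definition separable (X : topologicalType) : Prop :=
  exists2 S : set X, countable S & dense S.

(* [d] is only required to exist: being Polish is a property of the topology. *)
Definition completely_metrizable (R : realType) (X : topologicalType) : Prop :=
  exists d : X -> X -> R,
    [/\ forall x y, 0 <= d x y,
        forall x y, d x y = 0 <-> x = y,
        forall x y, d x y = d y x &
        forall x y z, d x z <= d x y + d y z] /\
    (forall (x : X) (A : set X),
      nbhs x A <-> exists2 e : R, 0 < e & [set y | d x y < e] `<=` A) /\
    (forall u : nat -> X,
      (forall e : R, 0 < e -> exists N : nat, forall m n : nat,
        (N <= m)%N -> (N <= n)%N -> d (u m) (u n) < e) ->
      exists l : X, u @ \oo --> l).

Definition polish (R : realType) (X : topologicalType) : Prop :=
  separable X /\ completely_metrizable R X.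

Notation borel X := (g_sigma_algebraType (@open X)).

(* [measurableType]s are pointed, hence the [ptopologicalType]s; a product
   carrying a probability measure has only nonempty factors anyway. *)
Definition product_space (I : Type) (X : I -> ptopologicalType) : Type :=
  prod_topology X.

HB.instance Definition _ (I : Type) (X : I -> ptopologicalType) :=
  Topological.copy (product_space X) (prod_topology X).
HB.instance Definition _ (I : Type) (X : I -> ptopologicalType) :=
  isPointed.Build (product_space X) (fun i => @point (X i)).

Definition prefix_space (T : nat) (X : 'I_T -> ptopologicalType) (t : nat) :
    ptopologicalType :=
  product_space (fun i : {i : 'I_T | (i < t)%N} => X (sval i)).

(* The first [t] coordinates; coordinates are numbered from 0. *)
Definition first_coords (T : nat) (X : 'I_T -> ptopologicalType) (t : nat)
    (x : product_space X) : prefix_space X t :=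
  fun i => x (sval i).
Arguments first_coords {T X} t x.

Section Entropy.
Context d (E : measurableType d) (R : realType).
Local Open Scope ereal_scope.
Local Open Scope charge_scope.

Definition relative_entropy (nu mu : probability E R) : \bar R :=
  if pselect (nu `<< mu) then
    \int[nu]_x lne (('d (charge_of_finite_measure nu) '/d mu) x)
  else +oo.

End Entropy.

Section ConditionalIndependence.
Context d (Omega : measurableType d) (R : realType) (P : probability Omega R).
Local Open Scope ereal_scope.

(* [f] is a version of P(A | Z). *)
Definition is_cond_prob d' (E : measurableType d') (Z : Omega -> E)
    (A : set Omega) (f : Omega -> R) : Prop :=
  [/\ measurable_fun setT (f : g_sigma_algebra_preimageType Z -> R),
      P.-integrable setT (EFin \o f) &
      forall C, g_sigma_algebra_preimage Z C ->
        \int[P]_(w in C) (f w)%:E = P (A `&` C)].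

(* P(A /\ B | Z) = P(A | Z) P(B | Z) a.s. for all A in sigma(U), B in sigma(V).
   Versions exist and are a.s. unique, so it is immaterial that they are
   quantified existentially. *)
Definition cond_independent dU dV dZ (EU : measurableType dU)
    (EV : measurableType dV) (EZ : measurableType dZ)
    (U : Omega -> EU) (V : Omega -> EV) (Z : Omega -> EZ) : Prop :=
  forall A B : set Omega,
    g_sigma_algebra_preimage U A -> g_sigma_algebra_preimage V B ->
    exists f g h : Omega -> R,
      [/\ is_cond_prob Z A f, is_cond_prob Z B g, is_cond_prob Z (A `&` B) h &
          {ae P, forall w, h w = (f w * g w)%R}].

End ConditionalIndependence.

Section Couplings.
Context (R : realType) (T : nat) (X : 'I_T -> ptopologicalType).
Local Open Scope ereal_scope.

Implicit Types mu nu : probability (borel (product_space X)) R.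
Implicit Type pi : probability (borel (product_space X * product_space X)%type) R.

Definition coupling mu nu pi : Prop :=
  (forall A : set (borel (product_space X)), measurable A -> pi (fst @^-1` A) = mu A) /\
  (forall A : set (borel (product_space X)), measurable A -> pi (snd @^-1` A) = nu A).

Definition bicausal mu nu pi : Prop :=
  coupling mu nu pi /\
  forall t : nat, (1 <= t < T)%N ->
    let Omega := borel (product_space X * product_space X)%type in
    let X_ : Omega -> borel (product_space X) := fst in
    let Y_ : Omega -> borel (product_space X) := snd in
    let Xt : Omega -> borel (prefix_space X t) := fun z => first_coords t z.1 in
    let Yt : Omega -> borel (prefix_space X t) := fun z => first_coords t z.2 in
    cond_independent pi Yt X_ Xt /\ cond_independent pi Xt Y_ Yt.

Definition ATV (phi : product_space X -> R) mu nu : \bar R :=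
  ereal_inf [set c | exists2 pi, bicausal mu nu pi &
    c = \int[pi]_z ((phi z.1 + phi z.2) * \1_[set w | w.1 <> w.2] z)%:E].

End Couplings.

(* Main.v *)
From HB Require Import structures.
From mathcomp Require Import all_boot all_order all_algebra.
From mathcomp Require Import all_classical all_reals all_analysis.
From mathcomp Require Import measurable_realfun ring lra.
Require Import Defs.
(** Let f be the density of nu with respect to mu (if there is none, the
    right-hand side is infinite), let F_t be the sigma-algebra of the first t
    coordinates and Z_t = E[f | F_t], so that Z_0 = 1 and Z_T = f.

    Couple two paths X ~ mu and Y ~ nu step by step: as long as they agree, the
    next coordinate is drawn from a maximal coupling of the two conditional laws;
    once they have differed, both continue independently. Such a coupling is
    bicausal. The mass that has not broken at time t has density M_t with
    respect to mu, where M_0 = 1 and M_(t+1) = M_t min(1, Z_(t+1) / Z_t)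
    (overlap). The mass that breaks at step s has the same conditional
    expectation given F_s under both laws (overlap_cond). It is carried by
    the relative product of mu with itself over F_s, with a density with respect
    to that relative product that makes the two marginals right
    (breaking_integral). The sum of these pieces and of M_T mu on the diagonal is
    the coupling (adapted_coupling_exists). Its marginals and causality follow
    by telescoping (coupling_form_adapted, coupling_form_congr), and its
    cost is at most the integral of phi (1 + f - 2 M_T).

    No regular conditional probabilities are used: the relative product is
    determined by its values E[1_A P(B | F_s)] on rectangles, and these extend to
    a measure because mu is Radon (radon_bimeasure_extension,
    relative_product_exists). Radonness is Ulam's tightness theorem together with
    the regularity of Borel measures (polish_tight, tight_radon).

    The cost is then bounded with h(r) = r ln r - r + 1 (entropy_fun). The step
    losses M_s - M_(s+1) have squares at most 2 Z_s h(Z_(s+1) / Z_s), and by the chain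
    rule (entropy_chain_rule) the sum of the expectations of
    Z_s h(Z_(s+1) / Z_s) is at most H = E[h(f)], which is at most the relative
    entropy. So 1 - M_T has squared L2 norm at most 2 T H (overlap_entropy). The
    Gibbs variational inequality (entropy_variational) bounds E[phi^2] by
    L = ln E[exp(phi^2)] and E[phi^2 f] by H + L. The Cauchy-Schwarz inequality
    yields the factor sqrt T for E[phi (1 - M_T)], which is counted twice, and the
    factor 1 for the remaining E[phi max(0, f - 1)]. *)

Set Implicit Arguments.
Unset Strict Implicit.
Unset Printing Implicit Defensive.
Import Order.TTheory GRing.Theory Num.Theory.
Import numFieldNormedType.Exports.
Local Open Scope classical_set_scope.
Local Open Scope ring_scope.

(** * Measures given by a density *)

Section density.
Context d (T : measurableType d) (R : realType).
Variables (mu : {measure set T -> \bar R}) (f : T -> R).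
Hypotheses (f0 : forall x, 0 <= f x) (mf : measurable_fun setT f).
Local Open Scope ereal_scope.
Import HBNNSimple.

Let dens (A : set T) := \int[mu]_(x in A) (f x)%:E.

Let mEf : measurable_fun setT (EFin \o f). Proof. exact/measurable_EFinP. Qed.

Let dens0 : dens set0 = 0. Proof. exact: integral_set0. Qed.

Let dens_ge0 A : 0 <= dens A.
Proof. by apply: integral_ge0 => x _; rewrite lee_fin. Qed.

Let dens_sigma_additive : semi_sigma_additive dens.
Proof.
move=> F mF tF mUF; rewrite /dens ge0_integral_bigcup//; last 2 first.
- exact: measurable_funTS.
- by move=> x _; rewrite lee_fin.
apply: is_cvg_ereal_nneg_natsum_cond => n _ _.
by apply: integral_ge0 => x _; rewrite lee_fin.
Qed.

HB.instance Definition _ :=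
  isMeasure.Build _ _ _ dens dens0 dens_ge0 dens_sigma_additive.

Let ge0_integral_dens_nnsfun (h : {nnsfun T >-> R}) :
  \int[dens]_x (h x)%:E = \int[mu]_x ((h x)%:E * (f x)%:E).
Proof.
have hE x : (h x)%:E =
    \sum_(y \in range h) (y * \1_(h @^-1` [set y]) x)%:E.
  by rewrite [in LHS]fimfunE fsumEFin.
rewrite [LHS](eq_integral (fun x => \sum_(y \in range h)
    (y * \1_(h @^-1` [set y]) x)%:E))//.
rewrite [RHS](eq_integral (fun x => \sum_(y \in range h)
    ((y * \1_(h @^-1` [set y]) x)%:E * (f x)%:E))); last first.
  move=> x _; rewrite hE ge0_mule_fsuml// => y.
  exact: nnfun_muleindic_ge0.
rewrite !ge0_integral_fsum//; last first.
- by move=> r x _; exact: nnfun_muleindic_ge0.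
- by move=> r; exact/measurable_EFinP/measurable_funM.
- by move=> r x _; apply: mule_ge0; [exact: nnfun_muleindic_ge0|rewrite lee_fin].
- by move=> r; apply: emeasurable_funM => //; exact/measurable_EFinP/measurable_funM.
apply: eq_fsbigr => r; rewrite inE => -[x _ <-{r}].
rewrite integralZl_indic_nnsfun// integral_indic// setIT.
under [RHS]eq_integral do rewrite EFinM -muleA.
rewrite ge0_integralZl//; last 3 first.
- by apply: emeasurable_funM => //; exact/measurable_EFinP.
- by move=> y _; rewrite mule_ge0// lee_fin.
- by rewrite lee_fin.
congr (_ * _); rewrite [LHS]integral_mkcond.
by apply: eq_integral => y _; rewrite epatch_indic muleC.
Qed.

Let ge0_integral_dens (g : T -> \bar R) : (forall x, 0 <= g x) ->
  measurable_fun setT g -> \int[dens]_x g x = \int[mu]_x (g x * (f x)%:E).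
Proof.
move=> g0 mg; pose h := nnsfun_approx measurableT mg.
have hg x : (h n x)%:E @[n --> \oo] --> g x by exact: cvg_nnsfun_approx.
have hnd x : {homo (fun n => (h n x)%:E) : a b / (a <= b)%N >-> a <= b}.
  by move=> a b ab; rewrite lee_fin; exact/lefP/nd_nnsfun_approx.
have mh n : measurable_fun setT (EFin \o h n) by exact/measurable_EFinP.
transitivity (limn (fun n => \int[dens]_x (h n x)%:E)).
  rewrite -monotone_convergence//.
  - by apply: eq_integral => x _; apply/esym/cvg_lim => //; exact: hg.
  - by move=> n x _; rewrite lee_fin.
under eq_fun do rewrite ge0_integral_dens_nnsfun.
rewrite -monotone_convergence//.
- by apply: eq_integral => x _; apply/cvg_lim => //; apply: cvgeZr => //; exact: hg.
- by move=> n; apply: emeasurable_funM; [exact: mh|exact: mEf].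
- by move=> n x _; rewrite mule_ge0// lee_fin.
- by move=> x _ a b ab; apply: lee_wpmul2r; [rewrite lee_fin|exact: hnd].
Qed.

(** The set function A |-> int_A f dmu is sigma-additive, and the formula for
    integrals passes from simple functions to nonnegative ones by monotone
    convergence. Changes of measure can then be carried out for densities whose
    integrability has not been established. *)
Lemma density_exists : exists m : {measure set T -> \bar R},
  (forall A, m A = \int[mu]_(x in A) (f x)%:E) /\
  (forall g : T -> \bar R, (forall x, 0 <= g x) -> measurable_fun setT g ->
    \int[m]_x g x = \int[mu]_x (g x * (f x)%:E)).
Proof. by exists dens; split => // g g0 mg; exact: ge0_integral_dens. Qed.

End density.

(** * Conditioning on the sigma-algebra of a map *)

Section conditioning.
Context d (T : measurableType d) (R : realType) d' (E : measurableType d').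
Variables (mu : {measure set T -> \bar R}) (p : T -> E).
Hypothesis mp : measurable_fun setT p.
Local Open Scope ereal_scope.

Definition adapted (f : T -> R) :=
  measurable_fun setT (f : g_sigma_algebra_preimageType p -> R).

(** Equality of the conditional expectations of g and g' given p. It is phrased
    through integrals over the events of that sigma-algebra, so that no version has
    to be chosen. *)
Definition same_cond (g g' : T -> R) := forall C, g_sigma_algebra_preimage p C ->
  \int[mu]_(x in C) (g x)%:E = \int[mu]_(x in C) (g' x)%:E.

Lemma preimage_measurable C : g_sigma_algebra_preimage p C -> measurable C.
Proof. by move=> [B mB <-]; exact: mp. Qed.

Lemma adapted_measurable f : adapted f -> measurable_fun setT f.
Proof. by move=> mf _ Y mY; apply: preimage_measurable; exact: mf. Qed.

Let id_sub : T -> g_sigma_algebra_preimageType p := id.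

Let mid_sub : measurable_fun setT id_sub.
Proof. by move=> _ Y mY; rewrite setTI; exact: preimage_measurable. Qed.

Lemma adapted_cst (r : R) : adapted (cst r).
Proof. exact: measurable_cst. Qed.

Lemma adapted_indic (C : set T) : g_sigma_algebra_preimage p C -> adapted (\1_C : T -> R).
Proof. by move=> FC; exact: measurable_indic. Qed.

(** An adapted conditional expectation can be divided by: the event where it
    vanishes belongs to the sigma-algebra, so g has integral zero there. *)
Lemma same_cond_null (g z : T -> R) : (forall x, 0 <= g x)%R ->
  measurable_fun setT g -> adapted z -> same_cond g z ->
  {ae mu, forall x, z x = 0%R -> g x = 0%R}.
Proof.
move=> g0 mg az gz; pose N := [set x | z x = 0%R].
have FN : g_sigma_algebra_preimage p N.
  by have := az measurableT _ (measurable_set1 0%R); rewrite setTI.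
have mN := preimage_measurable FN.
have intN : \int[mu]_(x in N) (g x)%:E = 0.
  by rewrite gz//; apply: integral0_eq => x /= ->.
have mEg : measurable_fun N (EFin \o g) by apply: measurable_funTS; exact/measurable_EFinP.
have /(ae_eq_integral_abs mu mN mEg) : \int[mu]_(x in N) `|(EFin \o g) x| = 0.
  by rewrite -[RHS]intN; apply: eq_integral => x _; rewrite /= ger0_norm.
by apply: filterS => x /[apply] -[].
Qed.

(** The measures g mu and g' mu agree on the sigma-algebra of p, hence have the
    same integrals of adapted functions. This is the tower property in the form
    used throughout. *)
Lemma same_cond_mul (g g' c : T -> R) : (forall x, 0 <= g x)%R ->
  (forall x, 0 <= g' x)%R -> measurable_fun setT g -> measurable_fun setT g' ->
  same_cond g g' -> (forall x, 0 <= c x)%R -> adapted c ->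
  \int[mu]_x (c x * g x)%:E = \int[mu]_x (c x * g' x)%:E.
Proof.
move=> g0 g'0 mg mg' gg' c0 ac.
have [m [mE mint]] := density_exists mu g0 mg.
have [m' [m'E m'int]] := density_exists mu g'0 mg'.
have mc : measurable_fun setT (EFin \o c).
  by apply/measurable_EFinP; exact: adapted_measurable.
transitivity (\int[m]_x (c x)%:E).
  by rewrite mint// => x; rewrite lee_fin.
transitivity (\int[m']_x (c x)%:E); last first.
  by rewrite m'int// => x; rewrite lee_fin.
have ac' : measurable_fun setT ((EFin \o c) : g_sigma_algebra_preimageType p -> _).
  exact/measurable_EFinP.
rewrite -[LHS](@ge0_integral_pushforward _ _ _ _ _ id_sub mid_sub m setT (EFin \o c))//; last first.
  by move=> x _; rewrite lee_fin.
rewrite -[RHS](@ge0_integral_pushforward _ _ _ _ _ id_sub mid_sub m' setT (EFin \o c))//; last first.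
  by move=> x _; rewrite lee_fin.
apply: eq_measure_integral => A mA _.
by rewrite /pushforward/= mE m'E gg'.
Qed.

Lemma same_cond_scale (g g' c : T -> R) : (forall x, 0 <= g x)%R ->
  (forall x, 0 <= g' x)%R -> measurable_fun setT g -> measurable_fun setT g' ->
  same_cond g g' -> (forall x, 0 <= c x)%R -> adapted c ->
  same_cond (fun x => c x * g x)%R (fun x => c x * g' x)%R.
Proof.
move=> g0 g'0 mg mg' gg' c0 ac C FC.
have mC := preimage_measurable FC.
have aC : adapted \1_C by exact: measurable_indic.
have step (h : T -> R) : (forall x, 0 <= h x)%R -> measurable_fun setT h ->
  \int[mu]_(x in C) (c x * h x)%:E = \int[mu]_x ((\1_C x * c x) * h x)%:E.
  move=> h0 mh; rewrite [LHS]integral_mkcond; apply: eq_integral => x _.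
  by rewrite epatch_indic -EFinM mulrC mulrA.
rewrite !step//; apply: same_cond_mul => //.
- by move=> x; rewrite mulr_ge0.
- exact: measurable_funM.
Qed.

End conditioning.

Section cond_expectation.
Context d (T : measurableType d) (R : realType) d' (E : measurableType d').
Variables (mu : {finite_measure set T -> \bar R}) (p : T -> E).
Hypothesis mp : measurable_fun setT p.
Local Open Scope ereal_scope.

(** Radon-Nikodym on the sub-sigma-algebra, applied to the restrictions of g mu
    and of mu. *)
Lemma cond_expectation_exists (g : T -> R) : (forall x, 0 <= g x)%R ->
  measurable_fun setT g -> \int[mu]_x (g x)%:E < +oo ->
  exists z : T -> R, [/\ forall x, (0 <= z x)%R, adapted p z & same_cond mu p g z].
Proof.
move=> g0 mg goo.
pose id_sub : T -> g_sigma_algebra_preimageType p := id.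
have mid_sub : measurable_fun setT id_sub.
  by move=> _ Y mY; rewrite setTI; exact: (preimage_measurable mp).
have [m [mE mint]] := density_exists mu g0 mg.
have mToo : pushforward m id_sub setT < +oo by rewrite /pushforward mE.
have muToo : pushforward mu id_sub setT < +oo.
  by have := fin_num_measure mu setT measurableT; rewrite ge0_fin_numE.
pose nu0 : {finite_measure set _ -> \bar R} :=
    @mfrestr _ _ R _ (pushforward m id_sub) measurableT mToo.
pose mu0 : {finite_measure set _ -> \bar R} :=
    @mfrestr _ _ R _ (pushforward mu id_sub) measurableT muToo.
pose nu1 := nu0 mid_sub; pose mu1 := mu0 mid_sub.
have nu1E A : nu1 A = m A by rewrite /nu1/nu0/= /mfrestr/= /mrestr setIT.
have mu1E A : mu1 A = mu A by rewrite /mu1/mu0/= /mfrestr/= /mrestr setIT.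
have dom : nu1 `<< mu1.
  apply/null_content_dominatesP => A mA A0; rewrite nu1E; have {}A0 : mu A = 0 by rewrite -[LHS]mu1E.
  rewrite mE; apply: null_set_integral => //.
  - exact: (preimage_measurable mp).
  - by apply: measurable_funTS; exact/measurable_EFinP.
have [f [f0 ffin fi fE]] := radon_nikodym_sigma_finite dom.
have mf : measurable_fun setT f by exact: measurable_int fi.
exists (fine \o f); split.
- by move=> x; exact: fine_ge0.
- by apply: measurableT_comp => //; exact: mf.
- move=> C FC; have mC : measurable (C : set (g_sigma_algebra_preimageType p)) by [].
  have := fE _ mC; rewrite nu1E mE => ->.
  transitivity (\int[pushforward mu id_sub]_(x in C) f x).
    by apply: eq_measure_integral => A mA _; exact: mu1E.
  rewrite ge0_integral_pushforward//; last exact: measurable_funTS.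
  by apply: eq_integral => x _ /=; rewrite fineK.
Qed.

End cond_expectation.

(** * Extending bimeasures from rectangles *)

Lemma measure_fin_union d (T : measurableType d) (R : realType)
    (m : {measure set T -> \bar R}) (I : finType) (P : pred I) (F : I -> set T) :
  (forall i, measurable (F i)) -> trivIset [set i | P i] F ->
  m (\bigcup_(i in [set i | P i]) F i) = (\sum_(i | P i) m (F i))%E.
Proof.
move=> mF tF; rewrite measure_fin_bigcup//; last exact: finite_finset.
rewrite (_ : [set i | P i] = [set` enum P]).
  by rewrite -fsbig_seq ?enum_uniq// big_enum.
by apply/seteqP; split => i /=; rewrite mem_enum.
Qed.

Section rectangle_semiring.
Context d (T : measurableType d).

(** An alias of T * T that carries the semiring of measurable rectangles in place
    of the product sigma-algebra. *)
Definition rectangle : Type := (T * T)%type.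

HB.instance Definition _ := Pointed.on rectangle.

Definition is_rectangle : set (set rectangle) :=
  [set S | exists A B, [/\ measurable A, measurable B & S = A `*` B]].

Let is_rectangle0 : is_rectangle set0.
Proof. by exists set0, set0; split => //; rewrite setX0. Qed.

Let is_rectangleI : setI_closed is_rectangle.
Proof.
move=> _ _ [A [B [mA mB ->]]] [C [D [mC mD ->]]].
exists (A `&` C), (B `&` D); split; [exact: measurableI|exact: measurableI|].
by rewrite setXI.
Qed.

Let is_rectangleD : semi_setD_closed is_rectangle.
Proof.
move=> _ _ [A [B [mA mB ->]]] [C [D [mC mD ->]]].
exists [set (A `\` C) `*` B; (A `&` C) `*` (B `\` D)]; split.
- by rewrite finite_setU; split; exact: finite_set1.
- move=> _ [->|->].
  + by exists (A `\` C), B; split => //; exact: measurableD.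
  + by exists (A `&` C), (B `\` D); split => //; [exact: measurableI|exact: measurableD].
- rewrite bigcup_setU !bigcup_set1; apply/seteqP; split => -[x y] /=.
    move=> [[Ax By] /not_andP CD]; have [Cx|Cx] := pselect (C x); last by left.
    by right; split => //; split => //; case: CD.
  by move=> [[[Ax Cx] By]|[[Ax Cx] [By Dy]]]; split => // -[].
- move=> _ _ [->|->] [->|->]// [[x y] [/=]].
  + by move=> [[Ax nCx] By] [[_ Cx]].
  + by move=> [[Ax Cx] By] [[_ nCx]].
Qed.

HB.instance Definition _ := @isSemiRingOfSets.Build d rectangle is_rectangle
  is_rectangle0 is_rectangleI is_rectangleD.

End rectangle_semiring.

Section content_extension.
Context d (T : semiRingOfSetsType d) (R : realType).
Variable c : {content set T -> \bar R}.
Hypothesis c_sub : measurable_subset_sigma_subadditive c.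

Let c' : set T -> \bar R := c.

HB.instance Definition _ := Content.on c'.

HB.instance Definition _ :=
  Content_SigmaSubAdditive_isMeasure.Build _ _ _ c' c_sub.

(** Caratheodory extension of a content that is only known to be countably
    subadditive on the semiring. *)
Lemma content_extension :
  exists m : {measure set (g_sigma_algebraType (@measurable _ T)) -> \bar R},
  forall A : set T, measurable A -> m A = c A.
Proof.
exists (measure_extension c') => A mA.
exact: (measurable_mu_extE (c' : {measure set T -> \bar R}) mA).
Qed.

End content_extension.

Section bimeasure.
Context d (T : measurableType d) (R : realType).
Variable m : set T -> {measure set T -> \bar R}.
Hypothesis m_sym : forall A B, measurable A -> measurable B -> m A B = m B A.
Local Open Scope ereal_scope.

Let m0 A : measurable A -> m set0 A = 0.
Proof. by move=> mA; rewrite m_sym. Qed.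

(** Refine the first side of the rectangles A_ i `*` B_ i by the atoms of the
    algebra that the A_ i generate: c x is the set of indices i with x in A_ i.
    Over one atom the B_ i with i in c x partition B, so additivity in one
    variable at a time is enough. *)
Lemma bimeasure_additive n (A_ B_ : 'I_n -> set T) (A B : set T) :
  (forall i, measurable (A_ i)) -> (forall i, measurable (B_ i)) ->
  measurable A -> measurable B ->
  A `*` B = \bigcup_i (A_ i `*` B_ i) ->
  trivIset setT (fun i => A_ i `*` B_ i) ->
  m B A = \sum_i m (B_ i) (A_ i).
Proof.
move=> mA_ mB_ mA mB AB tAB.
pose c x : {set 'I_n} := finset.finset (fun i => x \in A_ i).
have cE x i : (i \in c x) = (x \in A_ i) by rewrite finset.in_set.
pose P (I : {set 'I_n}) : set T := A `&` [set x | c x = I].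
have mP I : measurable (P I).
  apply: measurableI => //.
  rewrite (_ : [set x | _] =
      \bigcap_(i in setT) (if i \in I then A_ i else ~` A_ i)).
    by apply: fin_bigcap_measurable => // i _; case: ifP => // _; exact: measurableC.
  apply/seteqP; split => x /=.
    by move=> <- i _; rewrite cE; case: ifPn => [/set_mem//|/negP nA /mem_set].
  move=> cx; apply/setP => i; rewrite cE; move: (cx i Logic.I).
  by case: ifPn => _ Ax; [exact: mem_set|exact: memNset].
have tP (Q : pred {set 'I_n}) : trivIset [set I | Q I] P.
  by move=> I J _ _ [x [[_ <-] [_ <-]]].
have AE : A = \bigcup_(I in [set I : {set 'I_n} | true]) P I.
  by apply/seteqP; split => x => [Ax|[I _ []//]]; exists (c x).
have split1 B' : measurable B' -> m B' A = \sum_I m B' (P I).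
  by move=> mB'; rewrite {1}AE measure_fin_union.
have split2 i : m (B_ i) (A_ i) = \sum_(I : {set 'I_n} | i \in I) m (B_ i) (P I).
  have [->|/set0P[y By]] := eqVneq (B_ i) set0.
    by rewrite m0// big1// => I _; rewrite m0.
  rewrite -measure_fin_union//; congr (m _ _); apply/seteqP; split => x.
    move=> Ax; exists (c x); first by rewrite /= cE inE.
    split => //; have : (\bigcup_i (A_ i `*` B_ i)) (x, y) by exists i.
    by rewrite -AB => -[].
  by move=> [I /= iI [Ax cx]]; move: iI; rewrite -cx cE inE.
have split3 (I : {set 'I_n}) : m B (P I) = \sum_(i in I) m (B_ i) (P I).
  have [PI0|/set0P[x [Ax cx]]] := eqVneq (P I) set0.
    by rewrite PI0 measure0 big1.
  rewrite m_sym//; under eq_bigr do rewrite m_sym//.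
  rewrite -measure_fin_union//; last first.
    move=> i j /= iI jI [y [Biy Bjy]]; apply: tAB => //; exists (x, y).
    by split; split => //=; [move: iI|move: jI]; rewrite -cx cE inE.
  congr (m _ _); apply/seteqP; split => y.
    move=> By; have : (A `*` B) (x, y) by [].
    rewrite AB => -[i _ [/= Aix Biy]]; exists i => //=.
    by rewrite -cx cE inE.
  move=> [i /= iI Biy]; have : (\bigcup_i (A_ i `*` B_ i)) (x, y).
    by exists i => //; split => //=; move: iI; rewrite -cx cE inE.
  by rewrite -AB => -[].
rewrite split1//; under eq_bigr do rewrite split3.
under [RHS]eq_bigr do rewrite split2.
by rewrite (exchange_big_dep xpredT).
Qed.

(** A content is a function on all sets, so the sides of the rectangle are
    recovered as its projections; the empty rectangle, whose sides are not
    determined, gets mass 0 in every case. *)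
Definition rectangle_content (S : set (rectangle T)) : \bar R :=
  m (snd @` S) (fst @` S).

Lemma rectangle_contentE A B : measurable A -> measurable B ->
  rectangle_content (A `*` B) = m B A.
Proof.
move=> mA mB; rewrite /rectangle_content.
have [->|/set0P[x Ax]] := eqVneq A set0.
  by rewrite set0X !image_set0 !measure0.
have [->|/set0P[y By]] := eqVneq B set0.
  by rewrite setX0 !image_set0 measure0 m0.
congr (m _ _); apply/seteqP; split => z.
- by move=> [[a b] [/= Aa Bb] <-].
- by move=> Bz; exists (x, z).
- by move=> [[a b] [/= Aa Bb] <-].
- by move=> Az; exists (z, y).
Qed.

Let rectangle_content_ge0 S : 0 <= rectangle_content S.
Proof. exact: measure_ge0. Qed.

Let rectangle_content_additive : measure_function.semi_additive rectangle_content.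
Proof.
move=> F n mF tF mUF.
have /choice[G GE] : forall i, exists G : set T * set T,
    [/\ measurable G.1, measurable G.2 & F i = G.1 `*` G.2].
  by move=> i; have [A [B ?]] := mF i; exists (A, B).
have [A [B [mA mB UF]]] := mUF.
rewrite UF rectangle_contentE// (@bimeasure_additive n (fun i => (G i).1) (fun i => (G i).2) A B)//.
- apply: eq_bigr => i _; have [mG1 mG2 ->] := GE i.
  by rewrite rectangle_contentE.
- by move=> i; have [] := GE i.
- by move=> i; have [] := GE i.
- rewrite -UF -bigcup_mkord; apply/seteqP; split => x [i ].
    by move=> ni Fx; exists (Ordinal ni) => //; have [_ _ <-] := GE i.
  by have [_ _ <-] := GE i => _ Fx; exists i => //=.
- move=> i j _ _; have [_ _ <-] := GE i; have [_ _ <-] := GE j.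
  by move/(tF i j Logic.I Logic.I); exact: val_inj.
Qed.

HB.instance Definition _ := isContent.Build _ _ _ rectangle_content
  rectangle_content_ge0 rectangle_content_additive.

Lemma bimeasure_fin_subadditive (D : set nat) (A B : set T)
    (A_ B_ : nat -> set T) : finite_set D -> measurable A -> measurable B ->
  (forall i, measurable (A_ i)) -> (forall i, measurable (B_ i)) ->
  A `*` B `<=` \bigcup_(i in D) (A_ i `*` B_ i) ->
  m B A <= \sum_(i <oo) m (B_ i) (A_ i).
Proof.
move=> fD mA mB mA_ mB_ AB.
have mAB : measurable (A `*` B : set (rectangle T)) by exists A, B.
have mAB_ i : D i -> measurable (A_ i `*` B_ i : set (rectangle T)).
  by move=> _; exists (A_ i), (B_ i).
have := content_sub_fsum rectangle_content fD mAB_ mAB AB.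
rewrite /= rectangle_contentE// => /le_trans; apply.
rewrite nneseries_esum//; rewrite esum_ge//; exists D => //.
rewrite lee_fsum// => i _.
by rewrite rectangle_contentE.
Qed.

(** A function of two sets that is a measure in each variable need not come from
    a measure on the product. Countable subadditivity on rectangles is exactly
    what has to be added. *)
Lemma bimeasure_extension :
  (forall (A B : set T) (A_ B_ : nat -> set T), measurable A -> measurable B ->
    (forall i, measurable (A_ i)) -> (forall i, measurable (B_ i)) ->
    A `*` B `<=` \bigcup_i (A_ i `*` B_ i) ->
    m B A <= \sum_(i <oo) m (B_ i) (A_ i)) ->
  exists k : {measure set (g_sigma_algebraType (@measurable _ (rectangle T))) -> \bar R},
  forall A B : set T, measurable A -> measurable B -> k (A `*` B) = m B A.
Proof.
move=> m_sub.
have [A F mF [A0 [B0 [mA0 mB0 ->]]]|k kE] := @content_extension _ _ _ rectangle_content.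
  have /choice[G GE] : forall i, exists G : set T * set T,
      [/\ measurable G.1, measurable G.2 & F i = G.1 `*` G.2].
    by move=> i; have [C [D ?]] := mF i; exists (C, D).
  have FE i : F i = (G i).1 `*` (G i).2 by have [] := GE i.
  have mG1 i : measurable (G i).1 by have [] := GE i.
  have mG2 i : measurable (G i).2 by have [] := GE i.
  move=> ABF; rewrite /= rectangle_contentE//.
  rewrite (eq_eseriesr (g := fun i => m (G i).2 (G i).1)); last first.
    by move=> i _; rewrite FE; exact: rectangle_contentE.
  apply: m_sub => // x /ABF[i _ Fx]; exists i => //; by rewrite -FE.
exists k => A B mA mB; rewrite kE; last by exists A, B.
exact: rectangle_contentE.
Qed.

End bimeasure.

(** * Bimeasures dominated by a Radon measure *)

Lemma open_setX (X Y : topologicalType) (U : set X) (V : set Y) :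
  open U -> open V -> open (U `*` V).
Proof.
move=> oU oV; rewrite (_ : U `*` V = fst @^-1` U `&` snd @^-1` V)//.
by apply: openI; apply: open_comp => // x _; [exact: cvg_fst|exact: cvg_snd].
Qed.

Lemma compact_prod_cover (X : ptopologicalType) (K : set (X * X)) (I : choiceType)
    (D : set I) (f : I -> set (X * X)) :
  compact K -> (forall i, D i -> open (f i)) -> K `<=` cover D f ->
  finite_subset_cover D f K.
Proof.
(* Cover compactness is phrased over pointed spaces, so X * X is given a point *)
pose XX : ptopologicalType := HB.pack (X * X)%type
  (Topological.class (X * X)%type) (isPointed.Build (X * X)%type (point, point)).
move=> cK; have : cover_compact (K : set XX) by rewrite -compact_cover.
exact.
Qed.

Section radon_bimeasure.
Context (R : realType) (X : ptopologicalType).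
Variable mu : {finite_measure set (borel X) -> \bar R}.
Local Open Scope ereal_scope.

Definition radon := forall (A : set (borel X)) (e : R), measurable A -> (0 < e)%R ->
  (exists K : set (borel X), [/\ compact (K : set X), measurable K, K `<=` A & mu (A `\` K) <= e%:E]) /\
  (exists U : set (borel X), [/\ open (U : set X), A `<=` U & mu (U `\` A) <= e%:E]).

Variable m : set (borel X) -> {measure set (borel X) -> \bar R}.
Hypothesis m_sym : forall A B, measurable A -> measurable B -> m A B = m B A.
Hypothesis m_le : forall A B, measurable A -> measurable B -> m B A <= mu A.
Hypothesis mu_radon : radon.

(** Since m B A is at most mu A, changing a side of a rectangle costs at most the
    mu-measure of the change. *)
Let m_approx A A' B : measurable A -> measurable A' -> measurable B ->
  m B A <= m B A' + mu (A `\` A').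
Proof.
move=> mA mA' mB; have mD : measurable (A `\` A') by exact: measurableD.
rewrite (@le_trans _ _ (m B (A' `|` (A `\` A'))))//.
  apply: le_measure; rewrite ?inE//; first exact: measurableU.
  by move=> x Ax; have [A'x|A'x] := pselect (A' x); [left|right].
apply: (le_trans (measureU2 _ _ _)) => //.
by apply: leeD2l; exact: m_le.
Qed.

Let m_approx2 A A' B B' : measurable A -> measurable A' ->
  measurable B -> measurable B' ->
  m B A <= m B' A' + (mu (A `\` A') + mu (B `\` B')).
Proof.
move=> mA mA' mB mB'; apply: (le_trans (m_approx mA mA' mB)).
rewrite addeCA addeC; apply: leeD2r; rewrite m_sym// (m_sym mB')//.
exact: m_approx.
Qed.

(** A covered rectangle is shrunk to a product of compact sets and the covering
    ones are enlarged to products of open sets. By compactness finitely many of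
    them are enough, and then finite additivity applies. *)
Let m_sub (A B : set (borel X)) (A_ B_ : nat -> set (borel X)) :
  measurable A -> measurable B ->
  (forall i, measurable (A_ i)) -> (forall i, measurable (B_ i)) ->
  A `*` B `<=` \bigcup_i (A_ i `*` B_ i) ->
  m B A <= \sum_(i <oo) m (B_ i) (A_ i).
Proof.
move=> mA mB mA_ mB_ AB; apply/lee_addgt0Pr => e e0.
have e4 : (0 < e / 4)%R by rewrite divr_gt0.
have [[K [cK mK KA AK]] _] := mu_radon mA e4.
have [[L [cL mL LB BL]] _] := mu_radon mB e4.
(* Half of e is spent on shrinking A and B, the other half on enlarging the A_ i and B_ i *)
pose dl i := (e / 4 / (2 ^ i.+1)%:R)%R.
have dl0 i : (0 < dl i)%R by rewrite divr_gt0// ltr0n expn_gt0.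
have /choice[U UP] : forall i, exists U : set (borel X),
    [/\ open (U : set X), A_ i `<=` U & mu (U `\` A_ i) <= (dl i)%:E].
  by move=> i; have [_] := mu_radon (mA_ i) (dl0 i).
have /choice[V VP] : forall i, exists V : set (borel X),
    [/\ open (V : set X), B_ i `<=` V & mu (V `\` B_ i) <= (dl i)%:E].
  by move=> i; have [_] := mu_radon (mB_ i) (dl0 i).
have mU i : measurable (U i) by have [oU _ _] := UP i; exact: sub_sigma_algebra.
have mV i : measurable (V i) by have [oV _ _] := VP i; exact: sub_sigma_algebra.
have UV : (K `*` L : set (X * X)) `<=` \bigcup_i (U i `*` V i).
  move=> [x y] [/= /KA Ax /LB By]; have [//|i _ [/= Aix Biy]] := AB (x, y).
  by exists i => //; split; [have [_ + _] := UP i|have [_ + _] := VP i]; exact.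
have oUV (i : nat) : [set: nat] i -> open (U i `*` V i : set (X * X)).
  by move=> _; apply: open_setX; [have [] := UP i|have [] := VP i].
have [D _ DUV] := compact_prod_cover (compact_setX cK cL) oUV UV.
have KL : m L K <= \sum_(i <oo) m (V i) (U i).
  exact: (bimeasure_fin_subadditive m_sym (finite_fset D) mK mL mU mV DUV).
apply: (le_trans (m_approx2 mA mK mB mL)).
rewrite (_ : e = e / 2 + (e / 4 + e / 4))%R; last by field.
rewrite (EFinD (e / 2)) [leRHS]addeA; apply: leeD; last first.
  by rewrite EFinD; exact: leeD.
apply: (le_trans KL).
apply: le_trans (epsilon_trick _ _ _) => //; last by rewrite divr_ge0// ltW.
apply: lee_nneseries => // i _.
apply: (le_trans (m_approx2 (mU i) (mA_ i) (mV i) (mB_ i))).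
apply: leeD2l; rewrite (_ : (e / 2 / (2 ^ i.+1)%:R)%R = (dl i + dl i)%R); last first.
  by rewrite /dl; field.
by rewrite EFinD; apply: leeD; [have [] := UP i|have [] := VP i].
Qed.

(** This replaces the disintegration of measures on Polish spaces: a kernel would
    give the measure on the product directly, while here only the values on
    rectangles, which are conditional expectations, are available. *)
Lemma radon_bimeasure_extension :
  exists k : {measure set (g_sigma_algebraType (@measurable _ (rectangle (borel X)))) -> \bar R},
  forall A B : set (borel X), measurable A -> measurable B -> k (A `*` B) = m B A.
Proof. exact: bimeasure_extension. Qed.

End radon_bimeasure.

(** * Countable regular bases of Polish spaces *)

Lemma measure_bigcup_tail d (T : measurableType d) (R : realType)
    (mu : {finite_measure set T -> \bar R}) (F : nat -> set T) (e : R) :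
  (forall n, measurable (F n)) -> 0 < e ->
  exists N, (mu ((\bigcup_n F n) `\` (\bigcup_(n < N) F n)) <= e%:E)%E.
Proof.
move=> mF e0.
have mU : measurable (\bigcup_n F n) by exact: bigcupT_measurable.
have mN N : measurable (\bigcup_(n < N) F n) by apply: bigcup_measurable.
pose D N := (\bigcup_n F n) `\` (\bigcup_(n < N) F n).
have mD N : measurable (D N) by exact: measurableD.
have D0 : \bigcap_N D N = set0.
  apply/seteqP; split => // x Dx; have [[n _ Fnx] _] := Dx 0%N Logic.I.
  by have [_] := Dx n.+1 Logic.I; apply; exists n => /=.
have : (mu \o D) x @[x --> \oo] --> mu (\bigcap_N D N).
  apply: nonincreasing_cvg_mu => //.
  - by rewrite -ge0_fin_numE// fin_num_measure.
  - by rewrite D0.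
  - move=> m n mn; apply/subsetPset => x [Ux nx]; split => // -[i im Fx].
    by apply: nx; exists i => //=; exact: leq_trans im mn.
rewrite D0 measure0 => /fine_cvgP[_ /cvgrPdist_le/(_ _ e0)[N _ /(_ N)]] /=.
rewrite leqnn sub0r normrN => /(_ isT) DN; exists N.
rewrite -[leLHS]fineK; last by apply: fin_num_measure; exact: mD.
rewrite lee_fin.
by rewrite (le_trans (ler_norm _))// DN.
Qed.

Section metrizable.
Context (R : realType) (X : topologicalType) (d : X -> X -> R).
Hypotheses (d_ge0 : forall x y, 0 <= d x y)
  (d_eq0 : forall x y, d x y = 0 <-> x = y)
  (d_sym : forall x y, d x y = d y x)
  (d_triangle : forall x y z, d x z <= d x y + d y z)
  (d_nbhs : forall (x : X) (A : set X),
      nbhs x A <-> exists2 e : R, 0 < e & [set y | d x y < e] `<=` A).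

Lemma dist_self x : d x x = 0. Proof. by apply/d_eq0. Qed.

Lemma open_dball x e : open [set y | d x y < e].
Proof.
rewrite openE => y /= xy; apply/d_nbhs; exists (e - d x y); first by rewrite subr_gt0.
by move=> z /=; rewrite ltrBrDl; apply: le_lt_trans.
Qed.

Lemma closed_dball x e : closed [set y | d x y <= e].
Proof.
rewrite -openC openE => y /= /negP; rewrite -ltNge => xy.
apply/d_nbhs; exists (d x y - e); first by rewrite subr_gt0.
move=> z /= yz xz; have := d_triangle x z y; rewrite (d_sym z y); lra.
Qed.

Lemma metrizable_hausdorff : hausdorff_space X.
Proof.
rewrite open_hausdorff => x y xy.
have dxy : 0 < d x y.
  by rewrite lt_def d_ge0 andbT; apply: contra_neq xy => /d_eq0.
exists ([set z | d x z < d x y / 2], [set z | d y z < d x y / 2]) => /=.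
  by rewrite !inE/= !dist_self divr_gt0.
split; [exact: open_dball|exact: open_dball|].
apply/eqP/seteqP; split => // z [/= xz yz].
by have := d_triangle x z y; rewrite (d_sym z y); lra.
Qed.

End metrizable.

Lemma separable_sequence (X : ptopologicalType) :
  separable X -> exists g : nat -> X, forall U : set X, U !=set0 -> open U -> exists n, U (g n).
Proof.
move=> [S /pfcard_geP[->|[f]] dS].
  have [x [_ []]] := dS setT (ex_intro _ point Logic.I) openT.
exists f => U U0 oU; have [x [Ux Sx]] := dS U U0 oU.
have [n _ fn] : (f @` setT) x by apply: surj.
by exists n; rewrite fn.
Qed.

(** A base of pairs O i inside C i, open and closed. Indexed by a countable type
    it keeps what separable metrizability is used for, and unlike a metric it
    passes to finite products without any computation. *)
Definition regular_base (X : topologicalType) (I : Type) (O C : I -> set X) :=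
  [/\ forall i, open (O i), forall i, closed (C i), forall i, O i `<=` C i &
    forall x U, nbhs x U -> exists2 i, O i x & C i `<=` U].

Lemma exists_natSinv_lt (R : realType) (e : R) : 0 < e -> exists k, k.+1%:R^-1 < e.
Proof.
move=> e0; have [k _ /(_ k (leqnn k))] := near_infty_natSinv_lt (PosNum e0).
by exists k.
Qed.

Lemma polish_regular_base (R : realType) (X : ptopologicalType) : polish R X ->
  exists O C : nat * nat -> set X, regular_base O C.
Proof.
move=> [/separable_sequence[g gP] [d [[d0 d_eq0 d_sym d_tri] [d_nbhs _]]]].
(* i = (n, k) stands for the ball of radius 1/(k+1) around g n *)
exists (fun i => [set y | d (g i.1) y < i.2.+1%:R^-1]).
exists (fun i => [set y | d (g i.1) y <= i.2.+1%:R^-1]); split.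
- by move=> i; exact: open_dball d_nbhs _ _.
- by move=> i; exact: closed_dball d_nbhs _ _.
- by move=> i y /= /ltW.
- move=> x U /d_nbhs[e e0 eU].
  have [k ke] : exists k, k.+1%:R^-1 < e / 2 by apply: exists_natSinv_lt; rewrite divr_gt0.
  have [|n gn] := gP _ _ (open_dball d_tri d_nbhs x k.+1%:R^-1).
    by exists x; rewrite /= (dist_self d_eq0) invr_gt0.
  exists (n, k) => /=; first by rewrite d_sym.
  move=> y /= gy; apply: eU => /=; rewrite /= in gn.
  have xy := d_tri x (g n) y.
  by move: (k.+1%:R^-1) ke gy gn => q ke gy gn; lra.
Qed.

(** * Tightness *)

Lemma ultra_bigcup_ord (T : Type) (F : set_system T) (A : nat -> set T) N :
  UltraFilter F -> F (\bigcup_(n < N) A n) -> exists n, F (A n).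
Proof.
move=> FU; elim: N => [|N IH] FA.
  have [x [n]] := filter_ex FA; by rewrite /= ltn0.
have [FN|FN] := in_ultra_setVsetC (A N) FU; first by exists N.
apply: IH; apply: filterS (filterI FA FN) => x [[n /= nN Ax] nAx].
exists n => //=; move: nN; rewrite ltnS leq_eqVlt => /orP[/eqP nN|//].
by rewrite nN in Ax.
Qed.

Lemma closed_borel (X : ptopologicalType) (A : set (borel X)) : closed (A : set X) -> measurable A.
Proof.
move=> clA; rewrite -[A]setCK; apply: measurableC; apply: sub_sigma_algebra.
exact: closed_openC.
Qed.

(** Ulam's theorem. For each k finitely many balls of radius 1/(k+1) carry all but
    e / 2^(k+1) of the mass. The intersection over k of these finite unions is
    closed and totally bounded, hence compact by completeness; compactness is
    shown by means of ultrafilters, which must contain one ball at every scale. *)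
Lemma polish_tight (R : realType) (X : ptopologicalType)
    (mu : {finite_measure set (borel X) -> \bar R}) (e : R) : polish R X -> 0 < e ->
  exists K : set (borel X), [/\ compact (K : set X), closed (K : set X) &
    (mu (~` K) <= e%:E)%E].
Proof.
move=> [/separable_sequence[g gP] [d [[d0 d_eq0 d_sym d_tri] [d_nbhs d_cpl]]]] e0.
pose C k n : set (borel X) := [set y | d (g n) y <= k.+1%:R^-1].
have cC k n : closed (C k n : set X) by exact: closed_dball d_nbhs _ _.
have mC k n : measurable (C k n) by exact: closed_borel.
have CT k : \bigcup_n C k n = setT.
  apply/seteqP; split => // x _.
  have [|n gn] := gP _ _ (open_dball d_tri d_nbhs x k.+1%:R^-1).
    by exists x; rewrite /= (dist_self d_eq0) invr_gt0.
  by exists n => //; rewrite /C/= d_sym ltW.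
(* The errors sum up to e over k *)
pose eps k := e / (2 ^ k.+1)%:R.
have eps0 k : 0 < eps k by rewrite divr_gt0// ltr0n expn_gt0.
have /choice[N NP] : forall k, exists N, (mu (~` \bigcup_(n < N) C k n) <= (eps k)%:E)%E.
  move=> k; have [N] := measure_bigcup_tail mu (mC k) (eps0 k).
  by rewrite CT setTD; exists N.
pose B k : set (borel X) := \bigcup_(n < N k) C k n.
have cB k : closed (B k : set X).
  by apply: closed_bigcup => // n _; exact: cC.
have mB k : measurable (B k) by apply: bigcup_measurable => n _; exact: mC.
pose K : set (borel X) := \bigcap_k B k.
have cK : closed (K : set X) by apply: closed_bigI => k _; exact: cB.
exists K; split => //; last first.
  rewrite /K setC_bigcap.
  apply: (@le_trans _ _ (\sum_(k <oo) mu (~` B k))%E).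
    apply: generalized_Boole_inequality => [k|]; first exact: measurableC.
    by apply: bigcupT_measurable => k; exact: measurableC.
  apply: (@le_trans _ _ (\sum_(k <oo) (0 + (eps k)%:E))%E).
    by apply: lee_nneseries => // k _; rewrite add0e; exact: NP.
  apply: (le_trans (epsilon_trick _ _ _)) => //; first exact: ltW.
  by rewrite eseries0// add0e.
rewrite compact_ultra => F FU FK.
have /choice[w wP] : forall k, exists n, F (C k n).
  by move=> k; apply: (@ultra_bigcup_ord _ F (C k) (N k)); apply: filterS FK => x; apply.
pose u k := g (w k).
have du k l : d (u k) (u l) <= k.+1%:R^-1 + l.+1%:R^-1.
  have [y [/= ky ly]] := filter_ex (filterI (wP k) (wP l)).
  apply: (le_trans (d_tri _ y _)); rewrite lerD//; by rewrite d_sym.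
have inv_le k l : (k <= l)%N -> l.+1%:R^-1 <= k.+1%:R^-1 :> R.
  by move=> kl; rewrite lef_pV2 ?posrE// ler_nat.
have [|l ul] := d_cpl u.
  move=> r r0; have [k kr] : exists k, k.+1%:R^-1 < r / 2.
    by apply: exists_natSinv_lt; rewrite divr_gt0.
  exists k => m n km kn; apply: (le_lt_trans (du m n)).
  have := inv_le _ _ km; have := inv_le _ _ kn.
  by move: (k.+1%:R^-1) (m.+1%:R^-1) (n.+1%:R^-1) kr => a b c; lra.
have Fl : F --> l.
  move=> /= U /d_nbhs[r r0 rU].
  have [k kr] : exists k, k.+1%:R^-1 < r / 2.
    by apply: exists_natSinv_lt; rewrite divr_gt0.
  have : nbhs l [set y | d l y < r / 2].
    by apply/d_nbhs; exists (r / 2) => //; rewrite divr_gt0.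
  move=> /ul[M _ /(_ (maxn k M) (leq_maxr _ _))] /= lu.
  apply: filterS (wP (maxn k M)) => y /= uy; apply: rU => /=.
  have kM := inv_le _ _ (leq_maxl k M); have ly := d_tri l (u (maxn k M)) y.
  rewrite /C/= -/(u _) in uy; move: (_.+1%:R^-1) (k.+1%:R^-1) uy kM kr => a b uy kM kr.
  by lra.
exists l; split => //; apply: contrapT => nKl.
have /Fl FnK : nbhs l (~` K) by apply: open_nbhs_nbhs; split => //; exact: closed_openC.
by have [x []] := filter_ex (filterI FK FnK).
Qed.

(** * Finite products of Polish spaces *)

Lemma borel_measurable_fun d (T : measurableType d) (Y : ptopologicalType)
    (f : T -> borel Y) :
  (forall U : set Y, open U -> measurable (f @^-1` U)) -> measurable_fun setT f.
Proof.
move=> mf; apply: (@measurability _ _ T (borel Y) setT f (@open Y)) => //.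
by move=> _ [U oU <-]; rewrite setTI; exact: mf.
Qed.

Lemma continuous_borel_measurable (X Y : ptopologicalType) (f : X -> Y) :
  continuous f -> measurable_fun setT (f : borel X -> borel Y).
Proof.
move=> cf; apply: borel_measurable_fun => U oU; apply: sub_sigma_algebra.
by apply: open_comp => // x _; exact: cf.
Qed.

(** The restriction to the full set serves only to obtain a finite measure
    structure on the image measure. *)
Lemma finite_pushforward d d' (S : measurableType d) (T : measurableType d')
    (R : realType) (mu : {finite_measure set S -> \bar R}) (f : S -> T) :
  measurable_fun setT f -> exists m : {finite_measure set T -> \bar R},
    forall A, m A = mu (f @^-1` A).
Proof.
move=> mf.
have moo : (pushforward mu f setT < +oo)%E.
  by have := fin_num_measure mu setT measurableT; rewrite ge0_fin_numE.
pose m0 : {finite_measure set _ -> \bar R} :=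
  @mfrestr _ _ R _ (pushforward mu f) measurableT moo.
exists (m0 mf) => A.
by rewrite /m0/= /mfrestr/= /mrestr setIT.
Qed.

Lemma measure_fin_subadditive d (T : measurableType d) (R : realType)
    (m : {measure set T -> \bar R}) (I : finType) (F : I -> set T) :
  (forall i, measurable (F i)) ->
  (m (\bigcup_i F i) <= \sum_i m (F i))%E.
Proof.
move=> mF; have setTE : [set: I] = [set` enum I].
  by apply/seteqP; split => i //=; rewrite mem_enum.
have fI : finite_set [set: I] by [].
have mU : measurable (\bigcup_i F i) by exact: fin_bigcup_measurable.
rewrite (le_trans (content_sub_fsum m fI (fun i _ => mF i) mU (fun x h => h)))//.
by rewrite setTE -fsbig_seq ?enum_uniq// big_enum.
Qed.

Section finite_products.
Context (I : finType) (X : I -> ptopologicalType).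

Lemma coord_continuous i : continuous (fun x : product_space X => x i).
Proof. exact: proj_continuous. Qed.

(** The product topology is a supremum of initial topologies; for finitely many
    factors its neighborhoods are generated by boxes. The transport ecast moves
    a neighborhood in the factor i to the factor j when j = i. *)
Lemma nbhs_product (x : product_space X) (U : set (product_space X)) : nbhs x U ->
  exists V : forall i, set (X i), (forall i, nbhs (x i) (V i)) /\
    [set y : product_space X | forall i, V i (y i)] `<=` U.
Proof.
pose F : set_system (product_space X) := [set U | exists V : forall i, set (X i),
  (forall i, nbhs (x i) (V i)) /\ [set y | forall i, V i (y i)] `<=` U].
have FF : Filter F.
  split.
  - by exists (fun=> setT); split => // i; exact: filterT.
  - move=> A B [V [xV VA]] [W [xW WB]]; exists (fun i => V i `&` W i); split.
      by move=> i; exact: filterI.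
    by move=> y VWy; split; [apply: VA|apply: WB] => i; have [] := VWy i.
  - by move=> A B AB [V [xV VA]]; exists V; split => // y /VA /AB.
suff : F --> x by exact.
apply/cvg_sup => i {}U [_ [[W oW <-] Wxi WU]].
exists (fun j => [set y | forall e : j = i, W (ecast k (X k) e y)]); split.
  move=> j; have [ji|ji] := pselect (j = i); last first.
    by apply: filterS filterT => y _ e; case: ji.
  have xW : nbhs (x j) (ecast k (set (X k)) (esym ji) W).
    by subst j; exact: open_nbhs_nbhs.
  apply: filterS xW; subst j => y Wy e.
  by rewrite (eq_irrelevance e (erefl _)).
by move=> y Wy; apply: WU; exact: (Wy i erefl).
Qed.

Lemma open_box (V : forall i, set (X i)) : (forall i, open (V i)) ->
  open [set y : product_space X | forall i, V i (y i)].
Proof.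
move=> oV; rewrite openE => y Vy.
apply: (@filter_forall _ _ (fun i (y : product_space X) => V i (y i)) (nbhs y)) => i.
apply: coord_continuous.
by apply: open_nbhs_nbhs; split => //; exact: Vy.
Qed.

Lemma closed_box (V : forall i, set (X i)) : (forall i, closed (V i)) ->
  closed [set y : product_space X | forall i, V i (y i)].
Proof.
move=> cV; rewrite (_ : [set _ | _] = \bigcap_(i in setT) ((fun y : product_space X => y i) @^-1` V i)).
  apply: closed_bigI => i _; apply: closed_comp (cV i) => x _.
  exact: coord_continuous.
by apply/seteqP; split => y Vy i; [move=> _|]; exact: Vy.
Qed.

Lemma product_regular_base (J : countType) (O C : forall i, J -> set (X i)) :
  (forall i, regular_base (O i) (C i)) ->
  regular_base
    (fun w : {ffun I -> J} => [set y : product_space X | forall i, O i (w i) (y i)])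
    (fun w : {ffun I -> J} => [set y : product_space X | forall i, C i (w i) (y i)]).
Proof.
move=> OC; split.
- by move=> w; apply: (@open_box (fun i => O i (w i))) => i; have [] := OC i.
- by move=> w; apply: (@closed_box (fun i => C i (w i))) => i; have [] := OC i.
- by move=> w y Oy i; have [_ _ + _] := OC i; apply.
- move=> x U /nbhs_product[V [xV VU]].
  have /choice[w wP] : forall i, exists j, O i j (x i) /\ C i j `<=` V i.
    by move=> i; have [_ _ _ /(_ _ _ (xV i))[j]] := OC i; exists j.
  exists (finfun w) => [i|y Cy].
    by rewrite ffunE; have [] := wP i.
  by apply: VU => i; have [_] := wP i; apply; rewrite -[w i]ffunE.
Qed.

(** The product of compact sets that are almost full for the marginals. *)
Lemma product_tight (R : realType) (mu : {finite_measure set (borel (product_space X)) -> \bar R})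
    (e : R) : (forall i, polish R (X i)) -> 0 < e ->
  exists K : set (borel (product_space X)),
    [/\ compact (K : set (product_space X)), closed (K : set (product_space X)) &
    (mu (~` K) <= e%:E)%E].
Proof.
(* Dividing by #|I| + 1 also covers an empty index type *)
move=> pX e0; pose eps := e / #|I|.+1%:R.
have eps0 : 0 < eps by rewrite divr_gt0.
have mproj i : measurable_fun setT ((fun x : product_space X => x i) :
    borel (product_space X) -> borel (X i)).
  by apply: continuous_borel_measurable; exact: coord_continuous.
have exK i : exists K : set (X i), [/\ compact K, closed K &
    (mu (~` ((fun x : product_space X => x i) @^-1` K)) <= eps%:E)%E].
  have [m mE] := finite_pushforward mu (mproj i).
  have [K [cK clK mK]] := polish_tight m (pX i) eps0.
  by exists K; split => //; rewrite preimage_setC -mE.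
pose K i := sval (cid (exK i)); have KP i := svalP (cid (exK i)).
exists [set x | forall i, K i (x i)]; split.
- by apply: tychonoff => i; have [] := KP i.
- by apply: closed_box => i; have [] := KP i.
rewrite (_ : ~` _ = \bigcup_i ~` ((fun x : product_space X => x i) @^-1` K i)); last first.
  apply/seteqP; split => x /=.
    by move=> /existsNP[i Ki]; exists i.
  by move=> [i _ Ki] Kx; exact/Ki/Kx.
apply: (le_trans (measure_fin_subadditive _ _)) => [i|].
  apply: measurableC; rewrite -[X in measurable X]setTI; apply: mproj => //.
  by apply: closed_borel; have [] := KP i.
apply: (@le_trans _ _ (\sum_(i : I) eps%:E)%E).
  by apply: lee_sum => i _; have [] := KP i.
rewrite sumEFin lee_fin sumr_const -mulr_natr /eps -mulrA ler_piMr//; first exact: ltW.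
by rewrite mulrC ler_pdivrMr// mul1r ler_nat.
Qed.

End finite_products.

(** * Radon measures on spaces with a countable regular base *)

Section regular_spaces.
Context (R : realType) (X : ptopologicalType) (J : countType) (O C : J -> set X).
Hypothesis OC : regular_base O C.

Lemma open_Fsigma (U : set X) : open U ->
  exists F : nat -> set X, (forall n, closed (F n)) /\ U = \bigcup_n F n.
Proof.
move=> oU; have [_ clC OsC base] := OC.
exists (fun n => if unpickle n is Some i then
  (if `[< C i `<=` U >] then C i else set0) else set0); split.
  move=> n; case: unpickle => [i|]; last exact: closed0.
  by case: asboolP => _; [exact: clC|exact: closed0].
apply/seteqP; split => x.
  move=> Ux; have [i Oix CiU] := base x U (open_nbhs_nbhs (conj oU Ux)).
  by exists (pickle i) => //; rewrite pickleK; case: asboolP => // _; exact: OsC.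
by move=> [n _]; case: unpickle => // i; case: asboolP => // + Cix; apply.
Qed.

Variable mu : {finite_measure set (borel X) -> \bar R}.

Let regular (A : set (borel X)) := forall e : R, 0 < e -> exists F U : set (borel X),
  [/\ closed (F : set X), open (U : set X), F `<=` A, A `<=` U &
    (mu (U `\` F) <= e%:E)%E].

Let regular_open (A : set (borel X)) : open (A : set X) -> regular A.
Proof.
move=> oA e e0; have [F [clF AF]] := open_Fsigma oA.
have [N AN] := measure_bigcup_tail mu (fun n => closed_borel (clF n)) e0.
exists (\bigcup_(n < N) F n), A; split => //.
- by apply: closed_bigcup => // n _; exact: clF.
- by rewrite AF => x [n _ Fx]; exists n.
- by rewrite {1}AF.
Qed.

Let regularC (A : set (borel X)) : regular A -> regular (~` A).
Proof.
move=> rA e /rA[F [U [clF oU FA AU UF]]]; exists (~` U), (~` F); split.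
- exact: open_closedC.
- exact: closed_openC.
- exact: subsetC.
- exact: subsetC.
- by rewrite setDE setCK setIC -setDE.
Qed.

Let regular_bigcup (A : nat -> set (borel X)) : (forall n, regular (A n)) ->
  regular (\bigcup_n A n).
Proof.
move=> rA e e0; pose eps n := e / 2 / (2 ^ n.+1)%:R.
have eps0 n : 0 < eps n by rewrite divr_gt0 ?divr_gt0// ltr0n expn_gt0.
have /choice[F /choice[U FU]] : forall n, exists F : set (borel X), exists U : set (borel X),
  [/\ closed (F : set X), open (U : set X), F `<=` A n, A n `<=` U &
    (mu (U `\` F) <= (eps n)%:E)%E] by move=> n; exact: rA.
have mF n : measurable (F n) by apply: closed_borel; have [] := FU n.
have mU n : measurable (U n) by apply: sub_sigma_algebra; have [] := FU n.
have mD n : measurable (U n `\` F n) by exact: measurableD.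
have [||N FN] := @measure_bigcup_tail _ _ _ mu F (e / 2) => //.
  by rewrite divr_gt0.
exists (\bigcup_(n < N) F n), (\bigcup_n U n); split.
- by apply: closed_bigcup => // n _; have [] := FU n.
- by apply: bigcup_open => n _; have [] := FU n.
- by move=> x [n _ Fx]; exists n => //; have [_ _ + _ _] := FU n; exact.
- by move=> x [n _ Ax]; exists n => //; have [_ _ _ + _] := FU n; exact.
have mUF : measurable (\bigcup_n F n) by exact: bigcupT_measurable.
have mUN : measurable (\bigcup_(n < N) F n) by exact: bigcup_measurable.
have mUD : measurable (\bigcup_n (U n `\` F n)) by exact: bigcupT_measurable.
apply: (@le_trans _ _ (mu (\bigcup_n (U n `\` F n) `|`
    (\bigcup_n F n `\` \bigcup_(n < N) F n)))).
  apply: le_measure; rewrite ?inE.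
  - by apply: measurableD => //; exact: bigcupT_measurable.
  - by apply: measurableU => //; exact: measurableD.
  - move=> x [[n _ Ux] nF]; have [[k _ Fx]|nFx] := pselect ((\bigcup_n F n) x).
      by right; split => //; exists k.
    by left; exists n => //; split => // Fx; apply: nFx; exists n.
apply: (le_trans (measureU2 _ _ _)) => //; first exact: measurableD.
rewrite [e in leRHS]splitr EFinD; apply: leeD => //.
apply: (@le_trans _ _ (\sum_(n <oo) mu (U n `\` F n))%E).
  exact: (@measure_sigma_subadditive _ _ _ mu _ _ mD mUD (fun x h => h)).
apply: (@le_trans _ _ (\sum_(n <oo) (0 + (eps n)%:E))%E).
  by apply: lee_nneseries => // n _; rewrite add0e; have [] := FU n.
apply: (le_trans (epsilon_trick _ _ _)) => //; first by rewrite divr_ge0// ltW.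
by rewrite eseries0// add0e.
Qed.

(** The sets that can be approximated by closed sets from inside and by open sets
    from outside form a sigma-algebra, which contains the open sets because they
    are countable unions of closed sets. *)
Lemma borel_regular (A : set (borel X)) : measurable A -> regular A.
Proof.
move: A; apply: smallest_sub; last by move=> A; exact: regular_open.
split; [exact: regular_open open0|by move=> A rA; rewrite setTD; exact: regularC|].
exact: regular_bigcup.
Qed.

Lemma tight_radon : hausdorff_space X ->
  (forall e : R, 0 < e -> exists K : set (borel X), [/\ compact (K : set X),
    closed (K : set X) & (mu (~` K) <= e%:E)%E]) ->
  radon mu.
Proof.
move=> hX tight A e mA e0.
have e2 : 0 < e / 2 by rewrite divr_gt0.
have [F [U [clF oU FA AU UF]]] := borel_regular mA e2.
have mF := closed_borel clF.
have mU : measurable U by exact: sub_sigma_algebra.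
split; last first.
  exists U; split => //; apply: (@le_trans _ _ (mu (U `\` F))).
    by apply: le_measure; rewrite ?inE; [exact: measurableD..|exact: setDS].
  by apply: (le_trans UF); rewrite lee_fin; lra.
have [K [cK clK mK]] := tight _ e2.
have clFK : closed (F `&` K : set X) by exact: closedI.
have mKK := closed_borel clK.
exists (F `&` K); split.
- by apply: (subclosed_compact clFK cK) => x [].
- exact: closed_borel.
- by move=> x [/FA].
apply: (@le_trans _ _ (mu ((U `\` F) `|` ~` K))).
  apply: le_measure; rewrite ?inE.
  - by apply: measurableD => //; exact: closed_borel.
  - by apply: measurableU; [exact: measurableD|exact: measurableC].
  - move=> x [/AU Ux nFK]; have [Kx|] := pselect (K x); last by right.
    by left; split => // Fx; exact: nFK.
apply: (le_trans (measureU2 _ _ _)); [exact: measurableD|exact: measurableC|].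
by rewrite [e in leRHS]splitr EFinD; exact: leeD.
Qed.

(** A countable base makes every open set of X * X a countable union of open
    rectangles, so that the Borel sigma-algebra of the product is the product of
    the Borel sigma-algebras. *)
Lemma open_rectangles (U : set (X * X)) : open U ->
  <<s @measurable _ (rectangle (borel X)) >> U.
Proof.
move=> oU; have [opO _ OsC base] := OC.
pose D (ij : J * J) : set (X * X) := if `[< O ij.1 `*` O ij.2 `<=` U >] then O ij.1 `*` O ij.2 else set0.
have -> : U = \bigcup_ij D ij.
  apply/seteqP; split => [[x y] Uxy|z [[i j] _]]; last first.
    by rewrite /D; case: asboolP => // + Oz; apply.
  have [[A B] /= [xA yB] ABU] : nbhs (x, y) U by exact: open_nbhs_nbhs.
  have [i Oix CiA] := base x A xA; have [j Ojy CjB] := base y B yB.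
  exists (i, j) => //; rewrite /D; case: asboolP => //= + .
  by case => -[a b] /= [Oa Ob]; apply: ABU; split => /=; [apply/CiA/OsC|apply/CjB/OsC].
pose S : measurableType _ := g_sigma_algebraType (@measurable _ (rectangle (borel X))).
apply: (@countable_bigcupT_measurable _ S) => //.
move=> [i j]; rewrite /D/=; case: asboolP => _; last exact: measurable0.
apply: sub_sigma_algebra; exists (O i), (O j).
by split => //; apply: sub_sigma_algebra.
Qed.

End regular_spaces.

(** * The relative product over a sub-sigma-algebra *)

Section relative_product.
Context (R : realType) (X : ptopologicalType) d' (E : measurableType d').
Variables (mu : {finite_measure set (borel X) -> \bar R}) (p : borel X -> E).
Hypothesis mp : measurable_fun setT p.
Local Open Scope ereal_scope.

(** kappa is the law of two copies of a mu-distributed point that are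
    conditionally independent given p: kappa (A x B) is the integral over A of a
    version z of P(B | p). *)
Definition relative_product (kappa : {measure set (borel (X * X)%type) -> \bar R}) :=
  (forall A B : set (borel X), measurable A -> measurable B ->
    kappa (A `*` B) = kappa (B `*` A)) /\
  (forall B : set (borel X), measurable B -> exists z : borel X -> R,
    [/\ forall x, (0 <= z x)%R, adapted p z, same_cond mu p \1_B z &
      forall A : set (borel X), measurable A ->
        kappa (A `*` B) = \int[mu]_(x in A) (z x)%:E]).

(** The bimeasure m B A = E[1_A P(B | p)] is symmetric, because conditional
    expectation is self-adjoint, and it is at most mu A. So it extends to a
    measure on the product. *)
Lemma relative_product_exists : radon mu ->
  (forall U : set (X * X), open U ->
    <<s @measurable _ (rectangle (borel X)) >> U) ->
  exists kappa, relative_product kappa.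
Proof.
move=> mu_radon rect_open.
have cond_prob (B : set (borel X)) : exists m : {measure set (borel X) -> \bar R},
    measurable B -> exists z : borel X -> R,
    [/\ forall x, (0 <= z x)%R, adapted p z, same_cond mu p \1_B z &
      forall A, m A = \int[mu]_(x in A) (z x)%:E].
  have [mB|nmB] := pselect (measurable B); last by exists mu.
  have [| | |z [z0 az zB]] := @cond_expectation_exists _ _ _ _ _ mu _ mp \1_B.
  - by move=> x; rewrite indicE.
  - exact: measurable_indic.
  - by rewrite integral_indic// setIT -ge0_fin_numE// fin_num_measure.
  have [m [mE _]] := density_exists mu z0 (adapted_measurable mp az).
  by exists m => _; exists z.
have /choice[m mP] := cond_prob.
have m_sym (A B : set (borel X)) : measurable A -> measurable B -> m A B = m B A.
  suff bil (A' B' : set (borel X)) : measurable A' -> measurable B' ->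
      forall zA zB : borel X -> R, (forall x, (0 <= zA x)%R) -> (forall x, (0 <= zB x)%R) ->
      adapted p zA -> adapted p zB -> same_cond mu p \1_B' zB ->
      \int[mu]_(x in B') (zA x)%:E = \int[mu]_x (zA x * zB x)%:E.
    move=> mA mB; have [zA [zA0 aA cA mAE]] := mP A mA.
    have [zB [zB0 aB cB mBE]] := mP B mB.
    rewrite mAE mBE (bil A B mA mB _ zB)// (bil B A mB mA _ zA)//.
    by under eq_integral do rewrite mulrC.
  move=> mA' mB' zA zB zA0 zB0 aA aB cB.
  rewrite -(same_cond_mul mp _ zB0 _ _ cB)//.
  - rewrite [LHS]integral_mkcond; apply: eq_integral => x _.
    by rewrite epatch_indic EFinM.
  - exact: (adapted_measurable mp).
have m_le (A B : set (borel X)) : measurable A -> measurable B -> m B A <= mu A.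
  move=> mA mB; have [z [z0 az cz mE]] := mP A mA.
  rewrite m_sym//; apply: (@le_trans _ _ (m A setT)).
    by apply: le_measure; rewrite ?inE.
  rewrite mE -cz ?integral_indic ?setIT//.
  by exists setT => //; rewrite preimage_setT setTI.
have [k kE] := radon_bimeasure_extension m_sym m_le mu_radon.
pose S : measurableType _ := g_sigma_algebraType (@measurable _ (rectangle (borel X))).
pose i : S -> borel (X * X)%type := id.
have mi : measurable_fun setT i.
  apply: (@measurability _ _ S (borel (X * X)%type) setT i (@open (X * X)%type)) => //.
  by move=> _ [U oU <-]; rewrite setTI; exact: rect_open.
pose kappa0 : {measure set (borel (X * X)%type) -> \bar R} := pushforward k i.
exists (kappa0 mi); split.
  by move=> A B mA mB; rewrite /kappa0/= /pushforward/= !kE// m_sym.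
move=> B mB; have [z [z0 az cz mE]] := mP B mB; exists z; split => // A mA.
by rewrite /kappa0/= /pushforward/= kE.
Qed.

End relative_product.

(** * Conditionally independent pairs *)

Section conditionally_independent_pair.
Context (R : realType) d (T : measurableType d) d' (E : measurableType d')
  dO (Omega : measurableType dO).
Variables (mu : {finite_measure set T -> \bar R}) (p : T -> E).
Hypothesis mp : measurable_fun setT p.
Variables (kappa : {measure set Omega -> \bar R}) (u v : Omega -> T).
Hypotheses (mfu : measurable_fun setT u) (mfv : measurable_fun setT v).
Local Open Scope ereal_scope.

(** The relative product seen from a pair of maps u, v, so that the roles of the
    two coordinates can be exchanged. *)
Definition cond_pair :=
  (forall A, measurable A -> kappa (u @^-1` A) = mu A) /\
  (forall B, measurable B -> exists z : T -> R,
    [/\ forall x, (0 <= z x)%R, adapted p z, same_cond mu p \1_B z &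
      forall A, measurable A ->
        kappa (u @^-1` A `&` v @^-1` B) = \int[mu]_(x in A) (z x)%:E]).

Hypothesis kappaP : cond_pair.

Lemma cond_pair_marginal (G : T -> \bar R) : (forall x, 0 <= G x) ->
  measurable_fun setT G -> \int[kappa]_w G (u w) = \int[mu]_x G x.
Proof.
move=> G0 mG; rewrite -(ge0_integral_pushforward mfu kappa (D := setT))//.
by apply: eq_measure_integral => A mA _; exact: kappaP.1.
Qed.

Let rect_integral (G : T -> R) (B : set T) (z : T -> R) :
  (forall x, 0 <= G x)%R -> measurable_fun setT G -> measurable B ->
  (forall x, 0 <= z x)%R -> measurable_fun setT z ->
  (forall A, measurable A ->
    kappa (u @^-1` A `&` v @^-1` B) = \int[mu]_(x in A) (z x)%:E) ->
  \int[kappa]_(w in v @^-1` B) (G (u w))%:E = \int[mu]_x (z x * G x)%:E.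
Proof.
move=> G0 mG mB z0 mz zB.
have mBv : measurable (v @^-1` B) by rewrite -[_ @^-1` _]setTI; exact: mfv.
have mI : measurable_fun setT (\1_(v @^-1` B) : Omega -> R) by exact: measurable_indic.
have I0 w : (0 <= \1_(v @^-1` B) w :> R)%R by rewrite indicE.
have [m [mE mint]] := density_exists kappa I0 mI.
have [m' [m'E m'int]] := density_exists mu z0 mz.
have mEG : measurable_fun setT (EFin \o G) by exact/measurable_EFinP.
transitivity (\int[m]_w (G (u w))%:E).
  rewrite mint; last 2 first.
  - by move=> w; rewrite lee_fin.
  - by apply/measurable_EFinP; exact: measurableT_comp.
  by rewrite integral_mkcond; apply: eq_integral => w _; rewrite epatch_indic.
transitivity (\int[m']_x (G x)%:E); last first.
  rewrite m'int//.
  by apply: eq_integral => x _; rewrite EFinM muleC.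
rewrite -(ge0_integral_pushforward mfu m (D := setT) (f := EFin \o G))//; last first.
  by move=> x _; rewrite /= lee_fin.
apply: eq_measure_integral => A mA _.
rewrite m'E -zB// -[LHS]/(m (u @^-1` A)) mE integral_indic//.
- by rewrite setIC.
- by rewrite -[_ @^-1` _]setTI; exact: mfu.
Qed.

(** Given p, the point u w enters only through its conditional expectation. It is
    enough to test this on indicators H of v w, that is on the image under v of
    the measures with densities G and G'. *)
Lemma cond_pair_congr (G G' H : T -> R) : (forall x, 0 <= G x)%R ->
  (forall x, 0 <= G' x)%R -> (forall x, 0 <= H x)%R ->
  measurable_fun setT G -> measurable_fun setT G' -> measurable_fun setT H ->
  same_cond mu p G G' ->
  \int[kappa]_w (G (u w) * H (v w))%:E = \int[kappa]_w (G' (u w) * H (v w))%:E.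
Proof.
move=> G0 G'0 H0 mG mG' mH GG'.
have mGu (K : T -> R) : measurable_fun setT K -> measurable_fun setT (K \o u).
  by move=> mK; exact: measurableT_comp.
have [m [mE mint]] := density_exists kappa (fun w => G0 (u w)) (mGu _ mG).
have [m' [m'E m'int]] := density_exists kappa (fun w => G'0 (u w)) (mGu _ mG').
have mEH : measurable_fun setT (EFin \o H) by exact/measurable_EFinP.
have mHv : measurable_fun setT (fun w => (H (v w))%:E).
  by apply/measurable_EFinP; exact: measurableT_comp.
have swap (K : T -> R) : \int[kappa]_w (K (u w) * H (v w))%:E =
    \int[kappa]_w ((H (v w))%:E * (K (u w))%:E).
  by apply: eq_integral => w _; rewrite EFinM muleC.
rewrite !swap -mint -?m'int//; last 2 first.
- by move=> w; rewrite lee_fin.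
- by move=> w; rewrite lee_fin.
rewrite -(ge0_integral_pushforward mfv m (D := setT) (f := EFin \o H))//; last first.
  by move=> x _; rewrite /= lee_fin.
rewrite -(ge0_integral_pushforward mfv m' (D := setT) (f := EFin \o H))//; last first.
  by move=> x _; rewrite /= lee_fin.
apply: eq_measure_integral => B mB _.
have [z [z0 az zB zkappa]] := kappaP.2 B mB.
have mz := adapted_measurable mp az.
rewrite -[LHS]/(m (v @^-1` B)) -[RHS]/(m' (v @^-1` B)) mE m'E (rect_integral G0 mG mB z0 mz)//.
by rewrite (rect_integral G'0 mG' mB z0 mz)//; apply: (same_cond_mul mp).
Qed.

(** Both points have the same image under p. If c were different at the two
    points, a rational q would separate the values, while the event c < q is in
    the sigma-algebra of p and so occurs for both points or for neither, almost
    surely. *)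
Lemma cond_pair_adapted_ae (c : T -> R) : adapted p c ->
  {ae kappa, forall w, c (u w) = c (v w)}.
Proof.
move=> ac; have mc := adapted_measurable mp ac.
have null (C : set T) : g_sigma_algebra_preimage p C ->
    kappa (u @^-1` C `&` v @^-1` (~` C)) = 0.
  move=> FC; have mC := preimage_measurable mp FC.
  have [z [z0 az zB ->]] := kappaP.2 (~` C) (measurableC mC); last by [].
  by rewrite -zB// integral_indic//; [rewrite setICl measure0|exact: measurableC].
pose C (q : rat) : set T := [set x | (c x < ratr q)%R].
have FC q : g_sigma_algebra_preimage p (C q).
  have := ac measurableT [set r : R | (r < ratr q)%R].
  by rewrite setTI; apply; rewrite -set_itvNyo.
have FC' q : g_sigma_algebra_preimage p (~` C q).
  by have := @measurableC _ (g_sigma_algebra_preimageType p) (C q) (FC q).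
pose N : set Omega := \bigcup_(q : rat)
  ((u @^-1` (C q) `&` v @^-1` (~` C q)) `|` (u @^-1` (~` C q) `&` v @^-1` (C q))).
have mpre (w : Omega -> T) B : measurable_fun setT w -> measurable B -> measurable (w @^-1` B).
  by move=> mw mB; rewrite -[_ @^-1` _]setTI; exact: mw.
have mCq q := preimage_measurable mp (FC q).
have mC'q q := preimage_measurable mp (FC' q).
have mN1 q : measurable (u @^-1` (C q) `&` v @^-1` (~` C q)).
  by apply: measurableI; apply: mpre.
have mN2 q : measurable (u @^-1` (~` C q) `&` v @^-1` (C q)).
  by apply: measurableI; apply: mpre.
have mN : measurable N by apply: bigcupT_measurable_rat => q; exact: measurableU.
exists N; split => //.
- apply/eqP; rewrite eq_le measure_ge0 andbT.
  have [f fN] : exists f : nat -> set Omega, N = \bigcup_n f n /\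
      forall n, measurable (f n) /\ kappa (f n) = 0.
    exists (fun n => if unpickle n is Some q then
      (u @^-1` (C q) `&` v @^-1` (~` C q)) `|` (u @^-1` (~` C q) `&` v @^-1` (C q))
      else set0); split.
      apply/seteqP; split => w; first by move=> [q _ Nw]; exists (pickle q); rewrite ?pickleK.
      by move=> [n _]; case: unpickle => // q Nw; exists q.
    move=> n; case: unpickle => [q|]; last by rewrite measure0.
    split; first exact: measurableU.
    apply/eqP; rewrite eq_le measure_ge0 andbT.
    apply: (le_trans (measureU2 _ (mN1 q) (mN2 q))).
    by rewrite null// -[X in v @^-1` X](setCK (C q)) null// adde0.
  have [-> f0] := fN.
  apply: (@le_trans _ _ (\sum_(n <oo) kappa (f n))).
    apply: (@measure_sigma_subadditive _ _ _ kappa) => //.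
    - by move=> n; have [] := f0 n.
    - by apply: bigcupT_measurable => n; have [] := f0 n.
  by rewrite eseries0// => n _ _; have [] := f0 n.
- move=> w /= cuv.
  have sep (a b : R) : (a < b)%R -> exists q, (a < ratr q)%R /\ (ratr q <= b)%R.
    by move=> ab; have [q /itvP qab] := rat_in_itvoo ab; exists q; rewrite qab ltW ?qab.
  have [ab|ba|//] := ltgtP (c (u w)) (c (v w)).
  + have [q [uq qv]] := sep _ _ ab; exists q => //; left; split => //=.
    by apply/negP; rewrite -leNgt.
  + have [q [vq qu]] := sep _ _ ba; exists q => //; right; split => //=.
    by apply/negP; rewrite -leNgt.
Qed.

End conditionally_independent_pair.

(** * The part of the coupling that breaks at a given time *)

Section pair_projections.
Context (X : ptopologicalType).

Lemma measurable_fst_borel : measurable_fun setT (fst : borel (X * X)%type -> borel X).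
Proof.
apply: borel_measurable_fun => U oU; apply: sub_sigma_algebra.
by apply: open_comp => // x _; exact: cvg_fst.
Qed.

Lemma measurable_snd_borel : measurable_fun setT (snd : borel (X * X)%type -> borel X).
Proof.
apply: borel_measurable_fun => U oU; apply: sub_sigma_algebra.
by apply: open_comp => // x _; exact: cvg_snd.
Qed.

Lemma relative_product_cond_pair (R : realType) d' (E : measurableType d')
    (mu : {finite_measure set (borel X) -> \bar R}) (p : borel X -> E)
    (kappa : {measure set (borel (X * X)%type) -> \bar R}) :
  relative_product mu p kappa ->
  cond_pair mu p kappa (fst : borel (X * X)%type -> borel X) snd /\
  cond_pair mu p kappa (snd : borel (X * X)%type -> borel X) fst.
Proof.
move=> [ksym kz].
have kT (A : set (borel X)) : measurable A -> kappa ([set: borel X] `*` A) = mu A.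
  move=> mA; have [z [_ _ zA ->//]] := kz A mA.
  rewrite -zA ?integral_indic ?setIT//.
  by exists setT => //; rewrite preimage_setT setTI.
split; split.
- move=> A mA; rewrite -kT// -ksym//; congr (kappa _).
  by apply/seteqP; split => -[x y] /=; [|case].
- by move=> B mB; have [z [z0 az zB zk]] := kz B mB; exists z.
- move=> A mA; rewrite -kT//; congr (kappa _).
  by apply/seteqP; split => -[x y] /=; [|case].
- move=> B mB; have [z [z0 az zB zk]] := kz B mB; exists z; split => // A mA.
  rewrite -zk// -ksym//; congr (kappa _).
  by apply/seteqP; split => -[x y] /= [].
Qed.

End pair_projections.

Lemma measurable_fun_inv d (T : measurableType d) (R : realType) (f : T -> R) :
  (forall x, 0 <= f x) -> measurable_fun setT f ->
  measurable_fun setT (fun x => (f x)^-1).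
Proof.
move=> f0 mf; rewrite (_ : (fun _ => _) = (fun x => f x `^ (- 1))).
  by apply: (@measurableT_comp _ _ _ _ _ _ (fun y : R => y `^ (- 1)) _ f).
by apply/funext => x; rewrite powR_inv1.
Qed.

Section breaking_part.
Context (R : realType) d (T : measurableType d) d' (E : measurableType d')
  dO (Omega : measurableType dO).
Variables (mu : {finite_measure set T -> \bar R}) (p : T -> E).
Hypothesis mp : measurable_fun setT p.
Variables (kappa : {measure set Omega -> \bar R}) (u v : Omega -> T).
Hypotheses (mfu : measurable_fun setT u) (mfv : measurable_fun setT v).
Hypotheses (kuv : cond_pair mu p kappa u v) (kvu : cond_pair mu p kappa v u).
Variables A B sigma : T -> R.
Hypotheses (A0 : forall x, 0 <= A x) (B0 : forall x, 0 <= B x)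
  (sigma0 : forall x, 0 <= sigma x).
Hypotheses (mA : measurable_fun setT A) (mB : measurable_fun setT B)
  (asigma : adapted p sigma).
Hypotheses (Asigma : same_cond mu p A sigma) (Bsigma : same_cond mu p B sigma).
Local Open Scope ereal_scope.

(** The two points have the same image under p and are otherwise independent, with
    densities A and B with respect to mu. Both densities have the conditional
    expectation sigma, so that A (u) B (v) / sigma is the density of
    the conditionally independent pair with respect to kappa. *)
Definition breaking_integral (G H : T -> R) :=
  \int[kappa]_w ((A (u w) * G (u w) / sigma (u w)) * (B (v w) * H (v w)))%:E.

Let msigma := adapted_measurable mp asigma.

Let asigmaV : adapted p (fun x => (sigma x)^-1)%R.
Proof. exact: measurable_fun_inv. Qed.

Lemma breaking_congr (G G' H : T -> R) : (forall x, 0 <= G x)%R ->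
  (forall x, 0 <= G' x)%R -> (forall x, 0 <= H x)%R ->
  measurable_fun setT G -> measurable_fun setT G' -> measurable_fun setT H ->
  same_cond mu p (fun x => A x * G x)%R (fun x => A x * G' x)%R ->
  breaking_integral G H = breaking_integral G' H.
Proof.
move=> G0 G'0 H0 mG mG' mH GG'; rewrite /breaking_integral.
have nn (K : T -> R) : (forall x, 0 <= K x)%R -> forall x, (0 <= A x * K x / sigma x)%R.
  by move=> K0 x; rewrite !mulr_ge0// invr_ge0.
have mm (K : T -> R) : measurable_fun setT K -> measurable_fun setT (fun x => A x * K x / sigma x)%R.
  move=> mK; apply: measurable_funM; first exact: measurable_funM.
  exact: (adapted_measurable mp asigmaV).
apply: (@cond_pair_congr _ _ _ _ _ _ _ mu p mp kappa u v mfu mfv kuv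
  (fun x => A x * G x / sigma x)%R (fun x => A x * G' x / sigma x)%R
  (fun x => B x * H x)%R); [exact: nn|exact: nn| |exact: mm|exact: mm| |].
- by move=> x; rewrite mulr_ge0.
- exact: measurable_funM.
have eqK (K : T -> R) : (fun x => A x * K x / sigma x)%R =
    (fun x => (sigma x)^-1 * (A x * K x))%R by apply/funext => x; rewrite mulrC.
rewrite !eqK; apply: (same_cond_scale mp _ _ _ _ GG') => //.
- by move=> x; rewrite mulr_ge0.
- by move=> x; rewrite mulr_ge0.
- exact: measurable_funM.
- exact: measurable_funM.
- by move=> x; rewrite invr_ge0.
Qed.

Let A_null : {ae mu, forall x, sigma x = 0%R -> A x = 0%R}.
Proof. exact: (same_cond_null mp). Qed.

(** Against a function c known at the time of breaking the second path can be
    integrated out: c (v) may be replaced by c (u), B by its conditional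
    expectation sigma, and sigma cancels. *)
Lemma breaking_adapted (G c : T -> R) : (forall x, 0 <= G x)%R ->
  (forall x, 0 <= c x)%R -> measurable_fun setT G -> adapted p c ->
  breaking_integral G c = \int[mu]_x (A x * G x * c x)%:E.
Proof.
move=> G0 c0 mG ac; have mc := adapted_measurable mp ac.
pose K x := (A x * G x * c x / sigma x)%R.
have K0 x : (0 <= K x)%R by rewrite !mulr_ge0// invr_ge0.
have mK : measurable_fun setT K.
  apply: measurable_funM; last exact: (adapted_measurable mp asigmaV).
  by do 2 (apply: measurable_funM => //).
have mcomp (w : Omega -> T) (f : T -> R) : measurable_fun setT w ->
    measurable_fun setT f -> measurable_fun setT (fun x => f (w x)).
  by move=> mw mf; exact: measurableT_comp.
have mAG : measurable_fun setT (fun x => A x * G x / sigma x)%R.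
  apply: measurable_funM; last exact: (adapted_measurable mp asigmaV).
  exact: measurable_funM.
have mBc : measurable_fun setT (fun x => B x * c x)%R by exact: measurable_funM.
transitivity (\int[kappa]_w (B (v w) * K (u w))%:E).
  apply: ge0_ae_eq_integral => //.
  - apply/measurable_EFinP.
    exact: (measurable_funM (mcomp u _ mfu mAG) (mcomp v _ mfv mBc)).
  - by apply/measurable_EFinP; apply: measurable_funM; exact: mcomp.
  - by move=> w _; rewrite lee_fin !mulr_ge0// ?invr_ge0//.
  - by move=> w _; rewrite lee_fin mulr_ge0.
  have := cond_pair_adapted_ae mp mfu mfv kuv ac.
  apply: filterS => w cuv _; congr EFin; rewrite /K cuv; ring.
rewrite (cond_pair_congr mp mfv mfu kvu B0 sigma0 K0 mB msigma mK Bsigma).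
transitivity (\int[kappa]_w (sigma (u w) * K (u w))%:E).
  apply: ge0_ae_eq_integral => //.
  - by apply/measurable_EFinP; apply: measurable_funM; exact: mcomp.
  - by apply/measurable_EFinP; apply: measurable_funM; exact: mcomp.
  - by move=> w _; rewrite lee_fin mulr_ge0.
  - by move=> w _; rewrite lee_fin mulr_ge0.
  have := cond_pair_adapted_ae mp mfu mfv kuv asigma.
  by apply: filterS => w suv _; rewrite suv.
rewrite (cond_pair_marginal mfu kuv (G := fun x => (sigma x * K x)%:E)); last 2 first.
- by move=> x; rewrite lee_fin mulr_ge0.
- by apply/measurable_EFinP; exact: measurable_funM.
apply: ge0_ae_eq_integral => //.
- by apply/measurable_EFinP; exact: measurable_funM.
- by apply/measurable_EFinP; exact: (measurable_funM (measurable_funM mA mG) mc).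
- by move=> x _; rewrite lee_fin mulr_ge0.
- by move=> x _; rewrite lee_fin !mulr_ge0.
apply: filterS A_null => x Ax _; congr EFin; rewrite /K.
have [s0|s0] := eqVneq (sigma x) 0%R; first by rewrite Ax// s0 !mul0r.
by field.
Qed.

End breaking_part.

(** * From integral identities to conditional independence *)

Section causality.
Context (R : realType) dO (Omega : measurableType dO) d (T : measurableType d)
  d' (E : measurableType d').
Variables (pi : probability Omega R) (law : probability T R).
Variables (u v : Omega -> T) (p : T -> E).
Hypotheses (mfu : measurable_fun setT u) (mfv : measurable_fun setT v)
  (mp : measurable_fun setT p).
Local Open Scope ereal_scope.

Let mZ : measurable_fun setT (p \o u). Proof. exact: measurableT_comp. Qed.

Lemma cond_prob_intro (A : set Omega) (f : Omega -> R) : measurable A ->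
  (forall w, 0 <= f w)%R -> adapted (p \o u) f ->
  (forall C, g_sigma_algebra_preimage (p \o u) C ->
    \int[pi]_(w in C) (f w)%:E = pi (A `&` C)) ->
  is_cond_prob pi (p \o u) A f.
Proof.
move=> mA f0 af fA; split => //; apply/integrableP; split.
  by apply/measurable_EFinP; exact: (adapted_measurable mZ af).
rewrite (eq_integral (fun w => (f w)%:E)); last first.
  by move=> w _; rewrite /= ger0_norm.
rewrite fA; last by exists setT => //; rewrite preimage_setT setTI.
by rewrite setIT (le_lt_trans (probability_le1 _ _))// ltry.
Qed.

Lemma adapted_comp (g : T -> R) : adapted p g -> adapted (p \o u) (g \o u).
Proof.
move=> ag _ Y mY; rewrite setTI comp_preimage.
have := ag measurableT Y mY; rewrite setTI => -[S mS <-].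
by exists S => //; rewrite !setTI comp_preimage.
Qed.

(** Conditional independence of p (v) and u given p (u) means that the future of u
    gives no information on p (v). It is enough that, in integrals against events
    of p (v), functions of u can be replaced by others with the same conditional
    expectation under the law of u. *)
Lemma causal_cond_independent :
  (forall A, measurable A -> pi (u @^-1` A) = law A) ->
  (forall (G G' : T -> R) (B : set T), (forall x, 0 <= G x)%R ->
    (forall x, 0 <= G' x)%R -> measurable_fun setT G -> measurable_fun setT G' ->
    g_sigma_algebra_preimage p B -> same_cond law p G G' ->
    \int[pi]_w (G (u w) * \1_B (v w))%:E = \int[pi]_w (G' (u w) * \1_B (v w))%:E) ->
  cond_independent pi (p \o v) u (p \o u).
Proof.
move=> pi_u causal A B [B1 mB1 <-] [A' mA' <-]; rewrite !setTI.
pose B' := p @^-1` B1.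
have FB' : g_sigma_algebra_preimage p B' by exists B1; rewrite ?setTI.
have mB' := preimage_measurable mp FB'.
have mpre (w : Omega -> T) S : measurable_fun setT w -> measurable S -> measurable (w @^-1` S).
  by move=> mw mS; rewrite -[_ @^-1` _]setTI; exact: mw.
have mvB : measurable (v @^-1` B') by exact: mpre.
have muA : measurable (u @^-1` A') by exact: mpre.
have indic_lty dd (S : measurableType dd) (q : probability S R) (C : set S) :
    measurable C -> \int[q]_x (\1_C x)%:E < +oo.
  by move=> mC; rewrite integral_indic// setIT (le_lt_trans (probability_le1 _ _))// ltry.
have indic0 (S : Type) (C : set S) x : (0 <= \1_C x :> R)%R by rewrite indicE.
have mI dd (S : measurableType dd) (C : set S) : measurable C ->
    measurable_fun setT (\1_C : S -> R) by move=> mC; exact: measurable_indic.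
have [f [f0 af fA]] := cond_expectation_exists mZ
  (indic0 _ (v @^-1` B')) (mI _ _ _ mvB) (indic_lty _ _ pi _ mvB).
have [g [g0 ag gA]] := cond_expectation_exists mp
  (indic0 _ A') (mI _ _ _ mA') (indic_lty _ _ law _ mA').
have mg := adapted_measurable mp ag.
have agu := adapted_comp ag.
have preC C : g_sigma_algebra_preimage (p \o u) C ->
    exists2 C', g_sigma_algebra_preimage p C' & C = u @^-1` C'.
  by move=> [S mS <-]; exists (p @^-1` S); [exists S; rewrite ?setTI|rewrite setTI comp_preimage].
have fP : is_cond_prob pi (p \o u) (v @^-1` B') f.
  apply: cond_prob_intro => // C FC; rewrite -fA//.
  by rewrite integral_indic//; exact: (preimage_measurable mZ FC).
exists f, (g \o u), (fun w => f w * g (u w))%R; split => //.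
- apply: cond_prob_intro => //; first by move=> w /=.
  move=> C FC; have [C' FC' ->] := preC C FC.
  have mC' := preimage_measurable mp FC'.
  rewrite -preimage_setI pi_u; last exact: measurableI.
  transitivity (\int[pushforward pi u]_(x in C') (g x)%:E).
    rewrite ge0_integral_pushforward//; last by move=> x _; rewrite lee_fin.
    by apply: measurable_funTS; exact/measurable_EFinP.
  transitivity (\int[law]_(x in C') (g x)%:E).
    by apply: eq_measure_integral => S mS _; exact: pi_u.
  by rewrite -gA// integral_indic.
- apply: cond_prob_intro.
  + exact: measurableI.
  + by move=> w; rewrite mulr_ge0.
  + exact: measurable_funM.
  move=> C FC; have [C' FC' CE] := preC C FC.
  have mC' := preimage_measurable mp FC'.
  have aC : adapted (p \o u) (\1_C : Omega -> R) by exact: adapted_indic.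
  transitivity (\int[pi]_w ((\1_C w * g (u w)) * f w)%:E).
    rewrite integral_mkcond; apply: eq_integral => w _.
    by rewrite epatch_indic -EFinM; congr EFin; ring.
  rewrite -(same_cond_mul mZ (indic0 _ (v @^-1` B')) f0 _ _ fA); last 4 first.
  + exact: mI.
  + exact: (adapted_measurable mZ af).
  + by move=> w; rewrite mulr_ge0.
  + exact: measurable_funM.
  transitivity (\int[pi]_w ((\1_C' (u w) * g (u w)) * \1_B' (v w))%:E).
    by apply: eq_integral => w _; rewrite CE.
  rewrite (causal (fun x => \1_C' x * g x)%R (fun x => \1_C' x * \1_A' x)%R B')//.
  + transitivity (\int[pi]_w (\1_(v @^-1` B' `&` u @^-1` A' `&` C) w)%:E).
      apply: eq_integral => w _.
      rewrite !indicI/= CE -[\1_(u @^-1` A') w]/(\1_A' (u w)).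
      rewrite -[\1_(u @^-1` C') w]/(\1_C' (u w)) -[\1_(v @^-1` B') w]/(\1_B' (v w)).
      by congr EFin; ring.
    rewrite integral_indic ?setIT//.
    by apply: measurableI; [exact: measurableI|exact: (preimage_measurable mZ)].
  + by move=> x; rewrite mulr_ge0.
  + by apply: measurable_funM => //; exact: mI.
  + by apply: measurable_funM => //; exact: mI.
  + move=> S FS; apply: (same_cond_scale mp) => //.
    * by move=> S' FS'; rewrite gA.
    * exact: adapted_indic.
- exact: aeW.
Qed.

End causality.

(** * Couplings that break along a filtration *)

Section filtered_form.
Context (R : realType) d (T : measurableType d)
  dO (Omega : measurableType dO) (dE : nat -> measure_display)
  (E : forall t, measurableType (dE t)).
Variables (mu : {finite_measure set T -> \bar R}) (p : forall t, T -> E t) (N : nat).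
Hypothesis mp : forall t, measurable_fun setT (p t).
Hypothesis p_mono : forall s t, (s <= t)%N ->
  g_sigma_algebra_preimage (p s) `<=` g_sigma_algebra_preimage (p t).
Variables (kappa : nat -> {measure set Omega -> \bar R}) (u v : Omega -> T).
Hypotheses (mfu : measurable_fun setT u) (mfv : measurable_fun setT v).
Hypotheses (kuv : forall s, cond_pair mu (p s) (kappa s) u v)
  (kvu : forall s, cond_pair mu (p s) (kappa s) v u).
Variables (P D : T -> R) (n B sigma : nat -> T -> R).
Hypotheses (P0 : forall x, 0 <= P x) (mP : measurable_fun setT P)
  (D0 : forall x, 0 <= D x) (mD : measurable_fun setT D).
Hypotheses (n0 : forall t x, 0 <= n t x) (an : forall t, adapted (p t) (n t))
  (n_dec : forall t x, n t.+1 x <= n t x).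
Hypotheses (B0 : forall s x, 0 <= B s x) (mB : forall s, measurable_fun setT (B s))
  (sigma0 : forall s x, 0 <= sigma s x) (asigma : forall s, adapted (p s) (sigma s)).
Hypotheses (Asigma : forall s, (s < N)%N ->
    same_cond mu (p s) (fun x => (n s x - n s.+1 x) * P x) (sigma s))
  (Bsigma : forall s, (s < N)%N -> same_cond mu (p s) (B s) (sigma s)).
Hypothesis nPD : {ae mu, forall x, n N x * P x = D x}.
Local Open Scope ereal_scope.

Let A s x := ((n s x - n s.+1 x) * P x)%R.

(** The joint law of (u, v): at each time s < N a mass (n_s - n_(s+1)) P breaks
    off into a conditionally independent pair, and what is left at time N, of
    density D, stays on the diagonal. It is used twice, with the two coordinates
    exchanged; P is the density of the law of the coordinate u. *)
Definition coupling_form (G H : T -> R) :=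
  \sum_(0 <= s < N) breaking_integral (kappa s) u v (A s) (B s) (sigma s) G H
  + \int[mu]_x (D x * (G x * H x))%:E.

Lemma adapted_mono s t (f : T -> R) : (s <= t)%N -> adapted (p s) f -> adapted (p t) f.
Proof. by move=> st af _ Y mY; apply: (p_mono st); exact: af. Qed.

Lemma same_cond_mono s t (g g' : T -> R) : (s <= t)%N ->
  same_cond mu (p t) g g' -> same_cond mu (p s) g g'.
Proof. by move=> st gg' C FC; apply: gg'; exact: (p_mono st). Qed.

Let mn t : measurable_fun setT (n t). Proof. exact: (adapted_measurable (@mp t) (@an t)). Qed.

Let A0 s x : (0 <= A s x)%R. Proof. by rewrite mulr_ge0// subr_ge0. Qed.

Let mA s : measurable_fun setT (A s).
Proof. by apply: measurable_funM => //; exact: measurable_funB. Qed.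

(** Tested against a function c of the first t coordinates of v, the paths that
    break at time t or later look like a path that never breaks, and the masses
    telescope to n_t. *)
Lemma coupling_form_adapted t (G c : T -> R) : (t <= N)%N ->
  (forall x, 0 <= G x)%R -> (forall x, 0 <= c x)%R ->
  measurable_fun setT G -> adapted (p t) c ->
  coupling_form G c =
    \sum_(0 <= s < t) breaking_integral (kappa s) u v (A s) (B s) (sigma s) G c
    + \int[mu]_x ((n t x * c x) * (P x * G x))%:E.
Proof.
move=> tN G0 c0 mG ac; have mc := adapted_measurable (@mp t) ac.
rewrite /coupling_form (big_cat_nat (n := t))//= -addeA; congr (_ + _).
rewrite (eq_big_nat _ _ (F2 := fun s => \int[mu]_x (A s x * G x * c x)%:E)); last first.
  move=> s /andP[ts sN]; apply: (breaking_adapted (@mp s) mfu mfv) => //.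
  + exact: Asigma.
  + exact: Bsigma.
  + exact: adapted_mono ac.
have mAGc s : measurable_fun setT (fun x => (A s x * G x * c x)%:E).
  by apply/measurable_EFinP; exact: (measurable_funM (measurable_funM (mA s) mG) mc).
rewrite -(ge0_integral_sum mu measurableT mAGc); last first.
  by move=> s x _; rewrite lee_fin; apply: mulr_ge0 => //; exact: mulr_ge0.
rewrite -ge0_integralD//; last 4 first.
- by move=> x _; apply: sume_ge0 => s _; rewrite lee_fin; apply: mulr_ge0 => //; exact: mulr_ge0.
- by apply: emeasurable_sum => s; exact: mAGc.
- by move=> x _; rewrite lee_fin !mulr_ge0.
- by apply/measurable_EFinP; exact: (measurable_funM mD (measurable_funM mG mc)).
apply: ge0_ae_eq_integral => //.
- apply: emeasurable_funD; first by apply: emeasurable_sum => s; exact: mAGc.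
  by apply/measurable_EFinP; exact: (measurable_funM mD (measurable_funM mG mc)).
- apply/measurable_EFinP.
  exact: (measurable_funM (measurable_funM (mn t) mc) (measurable_funM mP mG)).
- move=> x _; apply: adde_ge0; last by rewrite lee_fin !mulr_ge0.
  by apply: sume_ge0 => s _; rewrite lee_fin; apply: mulr_ge0 => //; exact: mulr_ge0.
- by move=> x _; rewrite lee_fin !mulr_ge0.
apply: filterS nPD => x <- _; rewrite sumEFin -EFinD; congr EFin.
rewrite -!mulr_suml.
rewrite (@telescope_sumr_eq _ _ _ (fun s => - n s x)%R)//; first by ring.
by move=> s _; rewrite opprK addrC.
Qed.

(** Causality. In the pieces that break before time t, the point u enters only
    through conditional expectations given earlier information; the others
    depend on G only through P G integrated against the adapted n_t c. *)
Lemma coupling_form_congr t (G G' c : T -> R) : (t <= N)%N ->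
  (forall x, 0 <= G x)%R -> (forall x, 0 <= G' x)%R -> (forall x, 0 <= c x)%R ->
  measurable_fun setT G -> measurable_fun setT G' -> adapted (p t) c ->
  same_cond mu (p t) (fun x => P x * G x)%R (fun x => P x * G' x)%R ->
  coupling_form G c = coupling_form G' c.
Proof.
move=> tN G0 G'0 c0 mG mG' ac GG'.
have mc := adapted_measurable (@mp t) ac.
have PG0 x : (0 <= P x * G x)%R by rewrite mulr_ge0.
have PG'0 x : (0 <= P x * G' x)%R by rewrite mulr_ge0.
have mPG : measurable_fun setT (fun x => P x * G x)%R by exact: measurable_funM.
have mPG' : measurable_fun setT (fun x => P x * G' x)%R by exact: measurable_funM.
rewrite !(coupling_form_adapted tN)//; congr (_ + _); last first.
  apply: (same_cond_mul (@mp t)) => //; first by move=> x; rewrite mulr_ge0.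
  by apply: measurable_funM; [exact: an|exact: ac].
apply: eq_big_nat => s /andP[_ st]; have sN := leq_trans st tN.
apply: (breaking_congr (@mp s) mfu mfv) => //.
apply: (same_cond_mono (ltnW st)).
have adn : adapted (p t) (fun x => n s x - n s.+1 x)%R.
  by apply: measurable_funB; [exact: (adapted_mono (ltnW st))|exact: (adapted_mono st)].
have eqA (K : T -> R) : (fun x => A s x * K x)%R =
    (fun x => (n s x - n s.+1 x) * (P x * K x))%R.
  by apply/funext => x; rewrite /A mulrA.
by rewrite !eqA; apply: same_cond_scale => // x; rewrite subr_ge0.
Qed.

Lemma coupling_form_total (G : T -> R) : (forall x, n 0%N x = 1%R) ->
  (forall x, 0 <= G x)%R -> measurable_fun setT G ->
  coupling_form G (cst 1%R) = \int[mu]_x (P x * G x)%:E.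
Proof.
move=> n01 G0 mG; rewrite (@coupling_form_adapted 0)//; last exact: adapted_cst.
by rewrite big_nil add0e; apply: eq_integral => x _; rewrite n01 !mul1r.
Qed.

Variables (pi : probability Omega R) (law : probability T R).
Hypothesis n01 : forall x, n 0%N x = 1%R.
Hypothesis law_density : forall A, measurable A -> law A = \int[mu]_(x in A) (P x)%:E.
Hypothesis piE : forall G H : T -> R, (forall x, 0 <= G x)%R -> (forall x, 0 <= H x)%R ->
  measurable_fun setT G -> measurable_fun setT H ->
  \int[pi]_w (G (u w) * H (v w))%:E = coupling_form G H.

Lemma coupling_marginal S : measurable S -> pi (u @^-1` S) = law S.
Proof.
move=> mS; have mI : measurable_fun setT (\1_S : T -> R) by exact: measurable_indic.
have I0 x : (0 <= \1_S x :> R)%R by rewrite indicE.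
have := coupling_form_total n01 I0 mI; rewrite -piE//.
have muS : measurable (u @^-1` S) by rewrite -[_ @^-1` _]setTI; exact: mfu.
rewrite law_density// [X in _ = X -> _](_ : _ = \int[mu]_(x in S) (P x)%:E); last first.
  rewrite [RHS]integral_mkcond; apply: eq_integral => x _.
  by rewrite epatch_indic EFinM.
move=> <-; rewrite -[in LHS](setIT (u @^-1` S)) -integral_indic//.
by apply: eq_integral => w _; rewrite mulr1.
Qed.

Lemma law_same_cond t (G G' : T -> R) : (forall x, 0 <= G x)%R ->
  (forall x, 0 <= G' x)%R -> measurable_fun setT G -> measurable_fun setT G' ->
  same_cond law (p t) G G' ->
  same_cond mu (p t) (fun x => P x * G x)%R (fun x => P x * G' x)%R.
Proof.
move=> G0 G'0 mG mG' GG' C FC; have mC := preimage_measurable (@mp t) FC.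
have [m [mE mint]] := density_exists mu P0 mP.
have lawint (K : T -> R) : (forall x, 0 <= K x)%R -> measurable_fun setT K ->
    \int[law]_(x in C) (K x)%:E = \int[mu]_(x in C) (P x * K x)%:E.
  move=> K0 mK; transitivity (\int[m]_(x in C) (K x)%:E).
    by apply: eq_measure_integral => S mS _; rewrite mE; exact: law_density.
  rewrite integral_mkcond mint.
  - rewrite [RHS]integral_mkcond; apply: eq_integral => x _.
    by rewrite !patchE; case: ifPn => _; rewrite ?mul0e// EFinM muleC.
  - by move=> x; rewrite patchE; case: ifPn => // _; rewrite lee_fin.
  - by apply/(measurable_restrictT _ mC)/measurable_funTS; exact/measurable_EFinP.
by rewrite -!lawint//; exact: GG'.
Qed.

Lemma coupling_causal t : (t <= N)%N ->
  cond_independent pi (p t \o v) u (p t \o u).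
Proof.
move=> tN; apply: (causal_cond_independent mfu mfv (@mp t) coupling_marginal).
move=> G G' C G0 G'0 mG mG' FC GG'.
have mI : measurable_fun setT (\1_C : T -> R).
  by apply: measurable_indic; exact: (preimage_measurable (@mp t)).
have I0 x : (0 <= \1_C x :> R)%R by rewrite indicE.
rewrite !piE//; apply: (coupling_form_congr tN) => //; first exact: adapted_indic.
exact: law_same_cond.
Qed.

End filtered_form.

(** * The overlap process of two laws *)

Lemma addeIr (R : realDomainType) (x a b : \bar R) : x \is a fin_num ->
  (a + x = b + x -> a = b)%E.
Proof. by move=> xfin ab; rewrite -(addeK a xfin) ab addeK. Qed.

Section overlap.
Context (R : realFieldType) (T : Type) (Z : nat -> T -> R).

(** The probability, along x, that the coupling has not broken before time t: at
    each step the two conditional laws are coupled maximally, and the part of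
    the mu-conditional law that they share has density min(1, Z_(t+1) / Z_t). At
    times where Z_t = 0 the overlap is already 0. *)
Fixpoint overlap (t : nat) (x : T) : R :=
  if t is s.+1 then overlap s x * Num.min 1 (Z s.+1 x / Z s x) else 1.

(** The same probability seen from nu, the law of density Z with respect to mu. *)
Definition overlap_ratio (t : nat) (x : T) : R := overlap t x / Z t x.

Hypotheses (Z0 : forall t x, 0 <= Z t x) (Z01 : forall x, Z 0%N x = 1).

Lemma overlap_ge0 t x : 0 <= overlap t x.
Proof.
elim: t => [|t IH] /=; first by [].
by rewrite mulr_ge0// le_min ler01 divr_ge0.
Qed.

Lemma overlap_nonincreasing t x : overlap t.+1 x <= overlap t x.
Proof. by rewrite /= ler_piMr ?overlap_ge0// ge_min lexx. Qed.

Lemma overlap_le1 t x : overlap t x <= 1.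
Proof.
elim: t => [|t IH]; first by [].
exact: le_trans (overlap_nonincreasing t x) IH.
Qed.

Lemma overlap_le_density t x : overlap t x <= Z t x.
Proof.
elim: t => [|t IH]; first by rewrite Z01.
have [Zt0|Zt0] := eqVneq (Z t x) 0.
  by rewrite /= Zt0 invr0 mulr0 (_ : Num.min 1 0 = 0) ?mulr0//; apply/min_idPr.
rewrite /= (@le_trans _ _ (Z t x * (Z t.+1 x / Z t x)))//.
  apply: ler_pM => //; [exact: overlap_ge0| |by rewrite ge_min lexx orbT].
  by rewrite le_min ler01 divr_ge0.
by rewrite mulrC divfK.
Qed.

Lemma overlap_ratio_ge0 t x : 0 <= overlap_ratio t x.
Proof. by rewrite divr_ge0// overlap_ge0. Qed.

Lemma overlap_ratioM t x : overlap_ratio t x * Z t x = overlap t x.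
Proof.
rewrite /overlap_ratio; have [Zt0|Zt0] := eqVneq (Z t x) 0; last by rewrite divfK.
apply/eqP; rewrite Zt0 mulr0 eq_le overlap_ge0/=.
by rewrite -Zt0 overlap_le_density.
Qed.

Lemma overlap_ratio_nonincreasing t x : overlap_ratio t.+1 x <= overlap_ratio t x.
Proof.
rewrite /overlap_ratio /=.
have [Zs0|Zs0] := eqVneq (Z t.+1 x) 0.
  by rewrite Zs0 invr0 mulr0 divr_ge0// overlap_ge0.
have [Zt0|Zt0] := eqVneq (Z t x) 0.
  rewrite Zt0 invr0 !mulr0 (_ : Num.min 1 0 = 0) ?mulr0 ?mul0r//.
  exact/min_idPr.
have Zs_gt0 : 0 < Z t.+1 x by rewrite lt_def Zs0 Z0.
rewrite -mulrA ler_wpM2l ?overlap_ge0// ler_pdivrMr//.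
by rewrite ge_min [_^-1 * _]mulrC lexx orbT.
Qed.

Lemma overlap_ratio0 x : overlap_ratio 0 x = 1.
Proof. by rewrite /overlap_ratio Z01 divr1. Qed.

End overlap.

Section density_process.
Context (R : realType) d (T : measurableType d) (dE : nat -> measure_display)
  (E : forall t, measurableType (dE t)).
Variables (mu : probability T R) (p : forall t, T -> E t) (N : nat).
Hypothesis mp : forall t, measurable_fun setT (p t).
Hypothesis p_mono : forall s t, (s <= t)%N ->
  g_sigma_algebra_preimage (p s) `<=` g_sigma_algebra_preimage (p t).
Hypothesis p0 : forall C, g_sigma_algebra_preimage (p 0%N) C -> C = set0 \/ C = setT.
Hypothesis pN : forall C, measurable C -> g_sigma_algebra_preimage (p N) C.
Hypothesis N_gt0 : (0 < N)%N.
Variable f : T -> R.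
Hypotheses (f0 : forall x, 0 <= f x) (mf : measurable_fun setT f)
  (f1 : (\int[mu]_x (f x)%:E = 1)%E).

(** The conditional expectations of f. At the two ends the versions 1 and f can be
    chosen, which spares almost-everywhere statements later. *)
Lemma density_process_exists : exists Z : nat -> T -> R,
  [/\ forall t x, 0 <= Z t x, forall t, adapted (p t) (Z t),
      forall t, same_cond mu (p t) f (Z t), forall x, Z 0%N x = 1 & Z N = f].
Proof.
have /choice[Y YP] : forall t, exists z : T -> R,
    [/\ forall x, 0 <= z x, adapted (p t) z & same_cond mu (p t) f z].
  by move=> t; apply: (cond_expectation_exists (@mp t)) => //; rewrite f1 ltry.
exists (fun t => if t == 0%N then cst 1 else if t == N then f else Y t); split.
- by move=> t x; case: eqP => // _; case: eqP => // _; have [] := YP t.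
- move=> t; case: eqP => [_|_]; first exact: adapted_cst.
  case: eqP => [->|_]; last by have [] := YP t.
  by move=> _ S mS; apply: pN; exact: mf.
- move=> t; case: eqP => [->|_]; last first.
    by case: eqP => // _; have [] := YP t.
  move=> C /p0[->|->]; first by rewrite !integral_set0.
  by rewrite f1 -[LHS](probability_setT mu) -[LHS]mul1e -integral_cst.
- by move=> x; rewrite eqxx.
- by rewrite gtn_eqF// eqxx.
Qed.

Variable Z : nat -> T -> R.
Hypotheses (Z0 : forall t x, 0 <= Z t x) (aZ : forall t, adapted (p t) (Z t))
  (Zf : forall t, same_cond mu (p t) f (Z t)) (Z01 : forall x, Z 0%N x = 1).

Lemma overlap_adapted t : adapted (p t) (overlap Z t).
Proof.
elim: t => [|t IH]; first exact: adapted_cst.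
have up (g : T -> R) : adapted (p t) g -> adapted (p t.+1) g.
  exact: (adapted_mono p_mono).
apply: measurable_funM; first exact: up.
apply: measurable_minr; first exact: adapted_cst.
apply: measurable_funM; first exact: aZ.
by apply: measurable_fun_inv => //; exact: up.
Qed.

Lemma overlap_ratio_adapted t : adapted (p t) (overlap_ratio Z t).
Proof.
apply: measurable_funM; first exact: overlap_adapted.
by apply: measurable_fun_inv => //; exact: aZ.
Qed.

Local Open Scope ereal_scope.

Let intM t C : g_sigma_algebra_preimage (p t) C ->
  \int[mu]_(x in C) (overlap_ratio Z t x * f x)%:E = \int[mu]_(x in C) (overlap Z t x)%:E.
Proof.
move=> FC; rewrite (same_cond_scale (@mp t) f0 (Z0 t) mf _ (@Zf t) (overlap_ratio_ge0 Z0 t))//.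
- by apply: eq_integral => x _; rewrite overlap_ratioM.
- exact: (adapted_measurable (@mp t)).
- exact: overlap_ratio_adapted.
Qed.

(** At each step the mass that leaves the overlap has the same conditional
    expectation for both laws. This is why the parts that break can be matched. *)
Lemma overlap_cond s : same_cond mu (p s)
  (fun x => (overlap_ratio Z s x - overlap_ratio Z s.+1 x) * f x)%R
  (fun x => overlap Z s x - overlap Z s.+1 x)%R.
Proof.
move=> C FC; have mC := preimage_measurable (@mp s) FC.
have FC' := p_mono (leqnSn s) FC.
have mM t : measurable_fun C (EFin \o overlap Z t).
  apply/measurable_EFinP/measurable_funTS.
  exact: (adapted_measurable (@mp t) (@overlap_adapted t)).
have mk t : measurable_fun setT (overlap_ratio Z t).
  exact: (adapted_measurable (@mp t) (@overlap_ratio_adapted t)).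
have fin : \int[mu]_(x in C) (overlap Z s.+1 x)%:E \is a fin_num.
  rewrite ge0_fin_numE; last by apply: integral_ge0 => x _; rewrite lee_fin overlap_ge0.
  apply: (@le_lt_trans _ _ (\int[mu]_(x in C) (cst 1 x))).
    apply: ge0_le_integral => //; [|exact: mM|].
    - by move=> x _; rewrite lee_fin overlap_ge0.
    - by move=> x _; rewrite lee_fin overlap_le1.
  by rewrite integral_cst// mul1e (le_lt_trans (probability_le1 _ _))// ltry.
apply: (addeIr fin).
have mkf t : measurable_fun C (fun x => (overlap_ratio Z t x * f x)%:E).
  by apply/measurable_EFinP/measurable_funTS; exact: measurable_funM.
have mB (g : nat -> T -> R) (h : T -> R) : (forall t, measurable_fun setT (g t)) ->
    measurable_fun setT h ->
    measurable_fun C (fun x => ((g s x - g s.+1 x) * h x)%:E).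
  move=> mg mh; apply/measurable_EFinP/measurable_funTS.
  by apply: measurable_funM => //; exact: measurable_funB.
rewrite -[X in _ + X = _](intM FC').
rewrite -ge0_integralD//; last 3 first.
- by move=> x _; rewrite lee_fin mulr_ge0// subr_ge0 overlap_ratio_nonincreasing.
- exact: (mB (overlap_ratio Z) f mk mf).
- by move=> x _; rewrite lee_fin mulr_ge0// overlap_ratio_ge0.
rewrite -ge0_integralD//; last 4 first.
- by move=> x _; rewrite lee_fin subr_ge0 overlap_nonincreasing.
- apply/measurable_EFinP/measurable_funB; exact/measurable_EFinP/mM.
- by move=> x _; rewrite lee_fin overlap_ge0.
- exact: mM.
rewrite [LHS](eq_integral (fun x => (overlap_ratio Z s x * f x)%:E)); last first.
  by move=> x _; rewrite -EFinD; congr EFin; ring.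
rewrite (intM FC); apply: eq_integral => x _.
by rewrite -EFinD; congr EFin; ring.
Qed.

End density_process.

(** * The adapted coupling *)

Lemma probability_of_measure d (T : measurableType d) (R : realType)
    (m : {measure set T -> \bar R}) : m setT = 1%E ->
  exists P : probability T R, forall A, P A = m A.
Proof.
(* The Dirac mass is the value of mnormalize at total mass 0 or +oo only *)
move=> m1; exists (mnormalize m (\d_(point : T))) => A.
by rewrite /= /mnormalize m1 onee_eq0 (_ : (false || _) = false)//= invr1 mule1.
Qed.

Lemma measure_bigsum d (T : measurableType d) (R : realType)
    (m : nat -> {measure set T -> \bar R}) (m' : {measure set T -> \bar R}) N :
  exists q : {measure set T -> \bar R}, forall F : T -> \bar R,
    (forall x, 0 <= F x)%E -> measurable_fun setT F ->
    (\int[q]_x F x = \sum_(0 <= s < N) \int[m s]_x F x + \int[m']_x F x)%E.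
Proof.
exists (measure_add (msum m N) m') => F F0 mF.
by rewrite ge0_integral_measure_add// ge0_integral_measure_sum// big_mkord.
Qed.

Section coupling_construction.
Context (R : realType) (X : ptopologicalType) (dE : nat -> measure_display)
  (E : forall t, measurableType (dE t)).
Local Notation Omega := (borel (X * X)%type).
Variables (mu nu : probability (borel X) R) (p : forall t, borel X -> E t) (N : nat).
Hypothesis mp : forall t, measurable_fun setT (p t).
Hypothesis p_mono : forall s t, (s <= t)%N ->
  g_sigma_algebra_preimage (p s) `<=` g_sigma_algebra_preimage (p t).
Hypothesis mu_radon : radon mu.
Hypothesis rect_open : forall U : set (X * X), open U ->
  <<s @measurable _ (rectangle (borel X)) >> U.
Hypothesis X_hausdorff : hausdorff_space X.
Variables (f : borel X -> R) (Z : nat -> borel X -> R).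
Hypotheses (f0 : forall x, 0 <= f x) (mf : measurable_fun setT f)
  (nu_f : forall A, measurable A -> nu A = (\int[mu]_(x in A) (f x)%:E)%E).
Hypotheses (Z0 : forall t x, 0 <= Z t x) (aZ : forall t, adapted (p t) (Z t))
  (Zf : forall t, same_cond mu (p t) f (Z t)) (Z01 : forall x, Z 0%N x = 1)
  (ZN : Z N = f).
Local Open Scope ereal_scope.

Let u : Omega -> borel X := fst.
Let v : Omega -> borel X := snd.
Let mfu : measurable_fun setT u. Proof. exact: measurable_fst_borel. Qed.
Let mfv : measurable_fun setT v. Proof. exact: measurable_snd_borel. Qed.

Let M := overlap Z.
Let K := overlap_ratio Z.

Let M0 t x : (0 <= M t x)%R. Proof. exact: overlap_ge0. Qed.
Let K0 t x : (0 <= K t x)%R. Proof. exact: overlap_ratio_ge0. Qed.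
Let aM t : adapted (p t) (M t). Proof. exact: (overlap_adapted p_mono). Qed.
Let aK t : adapted (p t) (K t). Proof. exact: (overlap_ratio_adapted p_mono). Qed.
Let mM t : measurable_fun setT (M t). Proof. exact: (adapted_measurable (@mp t) (@aM t)). Qed.
Let mK t : measurable_fun setT (K t). Proof. exact: (adapted_measurable (@mp t) (@aK t)). Qed.

Let A s x := ((M s x - M s.+1 x) * 1)%R.
Let B s x := ((K s x - K s.+1 x) * f x)%R.

Let A0 s x : (0 <= A s x)%R.
Proof. by rewrite /A mulr1 subr_ge0 overlap_nonincreasing. Qed.
Let B0 s x : (0 <= B s x)%R.
Proof. by rewrite mulr_ge0// subr_ge0 overlap_ratio_nonincreasing. Qed.
Let mA s : measurable_fun setT (A s).
Proof. by apply: measurable_funM => //; exact: measurable_funB. Qed.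
Let mB s : measurable_fun setT (B s).
Proof. by apply: measurable_funM => //; exact: measurable_funB. Qed.

Let sigma_exists : exists sigma : nat -> borel X -> R, forall s,
  [/\ forall x, (0 <= sigma s x)%R, adapted (p s) (sigma s),
      same_cond mu (p s) (A s) (sigma s) & same_cond mu (p s) (B s) (sigma s)].
Proof.
have /choice[sigma sigmaP] : forall s, exists z : borel X -> R,
    [/\ forall x, (0 <= z x)%R, adapted (p s) z & same_cond mu (p s) (A s) z].
  move=> s; apply: (cond_expectation_exists (@mp s)) => //.
  apply: (@le_lt_trans _ _ (\int[mu]_x (cst 1 x))).
    apply: ge0_le_integral => //.
    - by move=> x _; rewrite lee_fin.
    - exact/measurable_EFinP.
    - move=> x _; rewrite lee_fin /A mulr1.
      rewrite (le_trans _ (overlap_le1 Z0 s x))// gerBl.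
      exact: M0.
  by rewrite integral_cst// mul1e; apply: (le_lt_trans (probability_le1 mu measurableT)); rewrite ltry.
exists sigma => s; have [s0 as' As] := sigmaP s; split => // C FC.
rewrite -As// [LHS](overlap_cond mp p_mono f0 mf Z0 aZ Zf Z01)//.
by apply: eq_integral => x _; rewrite /A mulr1.
Qed.

(** The cost of the coupling is at most the phi-mass of the two parts that break,
    which are 1 - M and f - M for the final overlap M. *)
Lemma adapted_coupling_exists : exists pi : probability Omega R,
  [/\ forall S, measurable S -> pi (u @^-1` S) = mu S,
      forall S, measurable S -> pi (v @^-1` S) = nu S,
      forall t, (t <= N)%N -> cond_independent pi (p t \o v) u (p t \o u) /\
        cond_independent pi (p t \o u) v (p t \o v) &
      forall phi : borel X -> R, (forall x, 0 <= phi x)%R -> measurable_fun setT phi ->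
        \int[pi]_z ((phi z.1 + phi z.2) * \1_[set w : X * X | w.1 <> w.2] z)%:E <=
        \int[mu]_x (phi x * (1 + f x - 2 * overlap Z N x))%:E].
Proof.
have [sigma sigmaP] := sigma_exists.
have sigma0 s x : (0 <= sigma s x)%R by have [] := sigmaP s.
have asigma s : adapted (p s) (sigma s) by have [] := sigmaP s.
have Asigma s : same_cond mu (p s) (A s) (sigma s) by have [] := sigmaP s.
have Bsigma s : same_cond mu (p s) (B s) (sigma s) by have [] := sigmaP s.
have msigma s : measurable_fun setT (sigma s) by exact: (adapted_measurable (@mp s)).
have /choice[kappa kappaP] : forall s, exists k, relative_product mu (p s) k.
  by move=> s; exact: (relative_product_exists (@mp s) mu_radon rect_open).
have kuv s : cond_pair mu (p s) (kappa s) u v.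
  by have [] := relative_product_cond_pair (kappaP s).
have kvu s : cond_pair mu (p s) (kappa s) v u.
  by have [] := relative_product_cond_pair (kappaP s).
have mcomp (w : Omega -> borel X) (g : borel X -> R) : measurable_fun setT w ->
    measurable_fun setT g -> measurable_fun setT (fun x => g (w x)).
  by move=> mw mg; exact: measurableT_comp.
pose W s (z : Omega) := (A s (u z) / sigma s (u z) * B s (v z))%R.
have W0 s z : (0 <= W s z)%R by apply: mulr_ge0 => //; apply: divr_ge0.
have mAs s : measurable_fun setT (fun x => A s x / sigma s x)%R.
  by apply: measurable_funM => //; exact: measurable_fun_inv.
have mW s : measurable_fun setT (W s).
  exact: (measurable_funM (mcomp u _ mfu (mAs s)) (mcomp v _ mfv (mB s))).
have /choice[m mP] := fun s => density_exists (kappa s) (W0 s) (mW s).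
have [md [_ mdint]] := density_exists mu (M0 N) (mM N).
pose diag (x : borel X) : Omega := (x, x).
have mdiag : measurable_fun setT diag.
  apply: (@measurability _ _ (borel X) Omega setT diag (@open (X * X)%type)) => //.
  move=> _ [U oU <-]; rewrite setTI; apply: sub_sigma_algebra.
  by apply: open_comp => // x _; exact: cvg_pair.
pose mdiag0 : {measure set Omega -> \bar R} := pushforward md diag.
have [q qint] := measure_bigsum m (mdiag0 mdiag) N.
have qE (F : Omega -> R) : (forall z, 0 <= F z)%R -> measurable_fun setT F ->
    \int[q]_z (F z)%:E = \sum_(0 <= s < N) \int[kappa s]_z (F z * W s z)%:E
      + \int[mu]_x (F (x, x) * M N x)%:E.
  move=> F0 mF; have mEF : measurable_fun setT (EFin \o F) by exact/measurable_EFinP.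
  rewrite qint//; congr (_ + _).
  - apply: eq_bigr => s _; have [_ ->//] := mP s.
  - rewrite ge0_integral_pushforward//; last by move=> z _; rewrite /= lee_fin.
    rewrite preimage_setT mdint.
    + by apply: eq_integral => x _; rewrite EFinM.
    + by move=> x; rewrite lee_fin.
    + by apply: (measurableT_comp mEF mdiag).
have Wuv s (G H : borel X -> R) :
    \int[kappa s]_z (G (u z) * H (v z) * W s z)%:E =
    breaking_integral (kappa s) u v (A s) (B s) (sigma s) G H.
  apply: eq_integral => z _; congr EFin; rewrite /W.
  by move: (A s (u z)) (B s (v z)) (sigma s (u z))^-1%R => a b c; ring.
have Wvu s (G H : borel X -> R) : (forall x, 0 <= G x)%R -> (forall x, 0 <= H x)%R ->
    measurable_fun setT G -> measurable_fun setT H ->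
    \int[kappa s]_z (G (v z) * H (u z) * W s z)%:E =
    breaking_integral (kappa s) v u (B s) (A s) (sigma s) G H.
  move=> G0 H0 mG mH.
  have mGH : measurable_fun setT (fun z => G (v z) * H (u z))%R.
    exact: (measurable_funM (mcomp v _ mfv mG) (mcomp u _ mfu mH)).
  apply: ge0_ae_eq_integral => //.
  - by apply/measurable_EFinP; exact: measurable_funM.
  - apply/measurable_EFinP; apply: measurable_funM.
      apply: (mcomp v (fun x => B s x * G x / sigma s x)%R mfv).
      apply: measurable_funM; first exact: measurable_funM.
      exact: measurable_fun_inv.
    by apply: (mcomp u (fun x => A s x * H x)%R mfu); exact: measurable_funM.
  - by move=> z _; rewrite lee_fin; apply: mulr_ge0 => //; apply: mulr_ge0.
  - move=> z _; rewrite lee_fin; apply: mulr_ge0; last exact: mulr_ge0.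
    exact: (divr_ge0 (mulr_ge0 (B0 s _) (G0 _)) (sigma0 s _)).
  have := cond_pair_adapted_ae (@mp s) mfu mfv (kuv s) (asigma s).
  apply: filterS => z suv _; congr EFin; rewrite /W suv.
  by move: (A s (u z)) (B s (v z)) (sigma s (v z))^-1%R => a b c; ring.
have quv (G H : borel X -> R) : (forall x, 0 <= G x)%R -> (forall x, 0 <= H x)%R ->
    measurable_fun setT G -> measurable_fun setT H ->
    \int[q]_z (G (u z) * H (v z))%:E =
    coupling_form mu N kappa u v (cst 1%R) (M N) M B sigma G H.
  move=> G0 H0 mG mH; rewrite qE; last 2 first.
  - by move=> z; rewrite mulr_ge0.
  - exact: (measurable_funM (mcomp u _ mfu mG) (mcomp v _ mfv mH)).
  congr (_ + _); first by apply: eq_bigr => s _; exact: Wuv.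
  by apply: eq_integral => x _; rewrite mulrC.
have qvu (G H : borel X -> R) : (forall x, 0 <= G x)%R -> (forall x, 0 <= H x)%R ->
    measurable_fun setT G -> measurable_fun setT H ->
    \int[q]_z (G (v z) * H (u z))%:E =
    coupling_form mu N kappa v u f (M N) K A sigma G H.
  move=> G0 H0 mG mH; rewrite qE; last 2 first.
  - by move=> z; rewrite mulr_ge0.
  - exact: (measurable_funM (mcomp v _ mfv mG) (mcomp u _ mfu mH)).
  congr (_ + _); first by apply: eq_bigr => s _; exact: Wvu.
  by apply: eq_integral => x _; rewrite mulrC.
have nPL : {ae mu, forall x, (M N x * cst 1 x = M N x)%R}.
  by apply: aeW => x; rewrite mulr1.
have nPR : {ae mu, forall x, (K N x * f x = M N x)%R}.
  by apply: aeW => x; rewrite -[in f x]ZN; exact: overlap_ratioM.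
have AsL s : (s < N)%N -> same_cond mu (p s)
    (fun x => (M s x - M s.+1 x) * cst 1 x)%R (sigma s) by move=> _; exact: Asigma.
have AsR s : (s < N)%N -> same_cond mu (p s)
    (fun x => (K s x - K s.+1 x) * f x)%R (sigma s) by move=> _; exact: Bsigma.
have q1 : q setT = 1.
  rewrite -[LHS]mul1e -integral_cst//.
  pose one : borel X -> R := cst 1%R.
  transitivity (\int[q]_z (one (u z) * one (v z))%:E).
    by apply: eq_integral => z _; rewrite /one/= mulr1.
  rewrite quv//; rewrite (coupling_form_total mp p_mono mfu mfv kuv kvu _ _
    (M0 N) (mM N) M0 aM (overlap_nonincreasing Z0) B0 mB sigma0 asigma AsL
    (fun s _ => Bsigma s) nPL)//.
  transitivity (\int[mu]_x (cst 1 x)).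
    by apply: eq_integral => x _; rewrite /= mulr1.
  rewrite integral_cst// mul1e; exact: (probability_setT mu).
have [pi piq] := probability_of_measure q1.
have piqint (F : Omega -> \bar R) : \int[pi]_z F z = \int[q]_z F z.
  by apply: eq_measure_integral => S _ _; exact: piq.
have law_mu S : measurable S -> mu S = \int[mu]_(x in S) (cst 1%R x)%:E.
  by move=> mS; rewrite -[LHS]mul1e -integral_cst.
have piuv (G H : borel X -> R) : (forall x, 0 <= G x)%R -> (forall x, 0 <= H x)%R ->
    measurable_fun setT G -> measurable_fun setT H ->
    \int[pi]_z (G (u z) * H (v z))%:E =
    coupling_form mu N kappa u v (cst 1%R) (M N) M B sigma G H.
  by move=> G0 H0 mG mH; rewrite piqint quv.
have pivu (G H : borel X -> R) : (forall x, 0 <= G x)%R -> (forall x, 0 <= H x)%R ->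
    measurable_fun setT G -> measurable_fun setT H ->
    \int[pi]_z (G (v z) * H (u z))%:E =
    coupling_form mu N kappa v u f (M N) K A sigma G H.
  by move=> G0 H0 mG mH; rewrite piqint qvu.
exists pi; split.
- move=> S mS.
  apply: (coupling_marginal mp p_mono mfu mfv kuv kvu _ _
    (M0 N) (mM N) M0 aM (overlap_nonincreasing Z0) B0 mB sigma0 asigma AsL
    (fun s _ => Bsigma s) nPL (fun _ => erefl) law_mu piuv) => //.
- move=> S mS.
  apply: (coupling_marginal mp p_mono mfv mfu kvu kuv f0 mf
    (M0 N) (mM N) K0 aK (overlap_ratio_nonincreasing Z0) A0 mA sigma0 asigma AsR
    (fun s _ => Asigma s) nPR (overlap_ratio0 Z01) nu_f pivu) => //.
- move=> t tN; split.
  + apply: (coupling_causal mp p_mono mfu mfv kuv kvu _ _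
      (M0 N) (mM N) M0 aM (overlap_nonincreasing Z0) B0 mB sigma0 asigma AsL
      (fun s _ => Bsigma s) nPL (fun _ => erefl) law_mu piuv tN) => //.
  + apply: (coupling_causal mp p_mono mfv mfu kvu kuv f0 mf
      (M0 N) (mM N) K0 aK (overlap_ratio_nonincreasing Z0) A0 mA sigma0 asigma AsR
      (fun s _ => Asigma s) nPR (overlap_ratio0 Z01) nu_f pivu tN) => //.
move=> phi phi0 mphi.
pose F (z : Omega) := ((phi z.1 + phi z.2) * \1_[set w : X * X | w.1 <> w.2] z)%R.
have mD : measurable ([set w | w.1 <> w.2] : set Omega).
  apply: sub_sigma_algebra; rewrite /= openE => -[a b] /= /eqP ab.
  have := X_hausdorff; rewrite open_hausdorff => /(_ a b ab)[[U V]/=].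
  rewrite !inE => -[Ua Vb] [oU oV UV0].
  exists (U, V) => /=; first by split; apply: open_nbhs_nbhs.
  move=> [c e] /= [Uc Ve] ce; have : (U `&` V) c by split => //; rewrite ce.
  by rewrite (UV0 : U `&` V = set0).
have mphiuv : measurable_fun setT (fun z : Omega => phi z.1 + phi z.2)%R.
  exact: (measurable_funD (mcomp u _ mfu mphi) (mcomp v _ mfv mphi)).
have mF : measurable_fun setT F.
  by apply: measurable_funM => //; exact: measurable_indic.
have F0 z : (0 <= F z)%R by rewrite mulr_ge0 ?addr_ge0// indicE.
rewrite piqint (qE F)// [X in _ + X]integral0_eq ?adde0; last first.
  by move=> x _; rewrite /F indicE memNset ?mulr0 ?mul0r//= => /(_ erefl).
have phis s : \int[kappa s]_z (F z * W s z)%:E <= \int[mu]_x ((A s x + B s x) * phi x)%:E.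
  have one0 (x : borel X) : (0 <= cst 1 x :> R)%R by [].
  have mone : measurable_fun setT (cst 1%R : borel X -> R) by exact: measurable_cst.
  have aone : adapted (p s) (cst 1%R : borel X -> R) by exact: adapted_cst.
  apply: (@le_trans _ _ (\int[kappa s]_z (phi (u z) * cst 1 (v z) * W s z)%:E
      + \int[kappa s]_z (phi (v z) * cst 1 (u z) * W s z)%:E)).
    rewrite -ge0_integralD//; last 4 first.
    - by move=> z _; rewrite lee_fin; apply: mulr_ge0 => //; exact: mulr_ge0.
    - apply/measurable_EFinP; apply: measurable_funM => //.
      exact: (measurable_funM (mcomp u _ mfu mphi) (mcomp v _ mfv mone)).
    - by move=> z _; rewrite lee_fin; apply: mulr_ge0 => //; exact: mulr_ge0.
    - apply/measurable_EFinP; apply: measurable_funM => //.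
      exact: (measurable_funM (mcomp v _ mfv mphi) (mcomp u _ mfu mone)).
    apply: ge0_le_integral => //.
    - by move=> z _; rewrite lee_fin mulr_ge0.
    - by apply/measurable_EFinP; exact: measurable_funM.
    - apply/measurable_EFinP.
      apply: measurable_funD.
      + apply: measurable_funM => //.
        exact: (measurable_funM (mcomp u _ mfu mphi) (mcomp v _ mfv mone)).
      + apply: measurable_funM => //.
        exact: (measurable_funM (mcomp v _ mfv mphi) (mcomp u _ mfu mone)).
    - move=> z _; rewrite -EFinD lee_fin -mulrDl ler_wpM2r//= /F !mulr1.
      by rewrite ler_piMr ?addr_ge0// indicE lern1 leq_b1.
  rewrite Wuv Wvu// (breaking_adapted (@mp s) mfu mfv (kuv s) (kvu s) (A0 s) (B0 s)
    (sigma0 s) (mA s) (mB s) (asigma s) (Asigma s) (Bsigma s))//.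
  rewrite (breaking_adapted (@mp s) mfv mfu (kvu s) (kuv s) (B0 s) (A0 s)
    (sigma0 s) (mB s) (mA s) (asigma s) (Bsigma s) (Asigma s))//.
  rewrite -ge0_integralD//; last 4 first.
  - by move=> x _; rewrite lee_fin; apply: mulr_ge0 => //; exact: mulr_ge0.
  - by apply/measurable_EFinP; apply: measurable_funM => //; exact: measurable_funM.
  - by move=> x _; rewrite lee_fin; apply: mulr_ge0 => //; exact: mulr_ge0.
  - by apply/measurable_EFinP; apply: measurable_funM => //; exact: measurable_funM.
  by rewrite le_eqVlt; apply/orP; left; apply/eqP; apply: eq_integral => x _;
    rewrite -EFinD /= !mulr1 mulrDl.
apply: le_trans (lee_sum _ (fun s _ => phis s)) _.
rewrite -ge0_integral_sum//; last 2 first.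
- move=> s; apply/measurable_EFinP; apply: measurable_funM => //.
  exact: measurable_funD.
- by move=> s x _; rewrite lee_fin mulr_ge0// addr_ge0.
rewrite le_eqVlt; apply/orP; left; apply/eqP; apply: eq_integral => x _.
rewrite sumEFin; congr EFin; rewrite -mulr_suml mulrC; congr (_ * _)%R.
rewrite (@telescope_sumr_eq _ _ _ (fun s => - (M s x + K s x * f x))%R)//; last first.
  by move=> s _; rewrite /A /B; ring.
have -> : (K N x * f x = M N x)%R by rewrite -[in f x]ZN; exact: overlap_ratioM.
have -> : K 0%N x = 1%R by exact: overlap_ratio0.
by rewrite /M/=; ring.
Qed.

End coupling_construction.

(** * The entropy function *)

Fact entropy_fun_key : unit. Proof. exact: tt. Qed.

Section entropy_function.
Context {R : realType}.
Implicit Types a r z w : R.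

(** The nonnegative integrand r ln r - r + 1. It is sealed: otherwise unification
    under an integral sign sees it as a sum. *)
Definition entropy_fun r : R := locked_with entropy_fun_key (r * ln r - r + 1).

Lemma entropy_funE r : entropy_fun r = r * ln r - r + 1.
Proof. by rewrite /entropy_fun unlock. Qed.

Lemma entropy_fun0 : entropy_fun 0 = 1.
Proof. by rewrite !entropy_funE mul0r subr0 add0r. Qed.

Lemma entropy_fun1 : entropy_fun 1 = 0.
Proof. by rewrite !entropy_funE ln1 mulr0 add0r addNr. Qed.

(** The convex conjugate of entropy_fun is a |-> exp a - 1. *)
Lemma young_entropy z a : 0 <= z -> z * a + 1 <= entropy_fun z + expR a.
Proof.
rewrite le_eqVlt => /predU1P[<-|z0].
  by rewrite mul0r add0r entropy_fun0 lerDl expR_ge0.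
have := expR_ge1Dx (a - ln z); rewrite expRB lnK ?posrE// ler_pdivlMr//.
rewrite !entropy_funE; set l := ln z; set e := expR a; nra.
Qed.

Lemma entropy_fun_ge0 z : 0 <= z -> 0 <= entropy_fun z.
Proof. by move/(young_entropy 0); rewrite mulr0 add0r expR0 lerDr. Qed.

(** The derivative of exp a - exp (- a) - 2 a is exp a + exp (- a) - 2, which is
    nonnegative. *)
Let sinh_ge a : 0 <= a -> 2 * a <= expR a - expR (- a).
Proof.
pose f x : R := expR x - expR (- x) - 2 * x.
have df (x : R) : is_derive x 1 f (expR x + expR (- x) - 2).
  by rewrite /f; apply: is_derive_eq; rewrite /GRing.scale/=; ring.
have f0 : f 0 = 0 by rewrite /f oppr0 expR0 mulr0 subrr subr0.
move=> a0; have : f 0 <= f a.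
  apply: (@ger0_derive1_ndecry R f 0) => //.
  - move=> x x0; rewrite derive1E derive_val.
    have ex : 0 < expR x by exact: expR_gt0.
    rewrite expRN -(pmulr_rge0 _ ex) mulrBr mulrDr divff ?gt_eqF//.
    by rewrite (_ : _ - _ = (expR x - 1) ^+ 2) ?sqr_ge0//; ring.
  - apply: derivable_within_continuous => x _; exact: ex_derive.
by rewrite f0 /f; lra.
Qed.

(** The derivative of the difference is 2 (1 - exp (- a)) ^ 2. *)
Let neg_ln_ge a : 0 <= a -> 3 - 4 * expR (- a) + expR (- a) ^+ 2 <= 2 * a.
Proof.
pose f x : R := 2 * x - 3 + 4 * expR (- x) - expR (- x) ^+ 2.
have df (x : R) : is_derive x 1 f (2 * (1 - expR (- x)) ^+ 2).
  by rewrite /f; apply: is_derive_eq; rewrite /GRing.scale/=; ring.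
have f0 : f 0 = 0 by rewrite /f oppr0 expR0 mulr0 expr1n; ring.
move=> a0; have : f 0 <= f a.
  apply: (@ger0_derive1_ndecry R f 0) => //.
  - by move=> x _; rewrite derive1E derive_val mulr_ge0// sqr_ge0.
  - apply: derivable_within_continuous => x _; exact: ex_derive.
by rewrite f0 /f; lra.
Qed.

(** With r = exp (- a) this is 2 a <= exp a - exp (- a). *)
Lemma entropy_fun_quad_le1 r : 0 <= r <= 1 -> (1 - r) ^+ 2 <= 2 * entropy_fun r.
Proof.
case/andP; rewrite le_eqVlt => /predU1P[<- _|r0 r1].
  by rewrite entropy_fun0 subr0 expr1n mulr1 ler1n.
have := @sinh_ge (- ln r); rewrite opprK oppr_ge0 ln_le0// => /(_ isT).
rewrite expRN lnK ?posrE//; have rr : r * r^-1 = 1 by rewrite divff// gt_eqF.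
rewrite !entropy_funE; move: (ln r) r^-1 rr => l s rs sinh.
have : r * (2 * - l) <= r * (s - r) by rewrite ler_pM2l.
by rewrite mulrBr rs; nra.
Qed.

(** With r = exp a this is 3 - 4 exp (- a) + exp (- 2 a) <= 2 a, multiplied by
    r ^ 2. *)
Lemma entropy_fun_quad_ge1 r : 1 <= r -> (r - 1) ^+ 2 <= 2 * r * entropy_fun r.
Proof.
move=> r1; have r0 : 0 < r by exact: lt_le_trans r1.
have := neg_ln_ge (ln_ge0 r1).
rewrite expRN lnK ?posrE//; have rr : r * r^-1 = 1 by rewrite divff// gt_eqF.
rewrite !entropy_funE; move: (ln r) r^-1 rr => l s rs lnle.
have : r ^+ 2 * (3 - 4 * s + s ^+ 2) <= r ^+ 2 * (2 * l) by rewrite ler_pM2l// exprn_gt0.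
have -> : r ^+ 2 * (3 - 4 * s + s ^+ 2) = 3 * r ^+ 2 - 4 * r * (r * s) + (r * s) ^+ 2 by ring.
by rewrite rs; nra.
Qed.

Definition ln_pos z := Num.max 0 (ln z).
Definition ln_neg z := Num.max 0 (- ln z).

Lemma ln_posneg z : ln_pos z - ln_neg z = ln z.
Proof. by rewrite /ln_pos /ln_neg; case: (leP 0 (ln z)); case: (leP 0 (- ln z)); lra. Qed.

(** The pointwise chain rule of relative entropy, arranged so that all terms are
    nonnegative: the terms with ln z have been split into positive and negative
    parts and moved to the side where they are nonnegative. It can then be
    integrated without integrability conditions. *)
Lemma entropy_chain z w : 0 <= z -> 0 <= w -> (z = 0 -> w = 0) ->
  entropy_fun w + (ln_neg z * w + ln_pos z * z) =
  (entropy_fun z + z * entropy_fun (w / z)) + (ln_pos z * w + ln_neg z * z).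
Proof.
move=> z0 w0 zw; have lz := ln_posneg z.
have [ze|zN0] := eqVneq z 0.
  by rewrite (zw ze) ze; ring.
have z_gt0 : 0 < z by rewrite lt_def zN0.
have [->|wN0] := eqVneq w 0.
  by rewrite mul0r entropy_fun0 entropy_funE -lz; ring.
have w_gt0 : 0 < w by rewrite lt_def wN0.
rewrite !entropy_funE ln_div ?posrE// -lz.
have := divfK zN0 w; move: (w / z) (ln w) => q l <-; ring.
Qed.

Lemma ln_neg_mul z : 0 <= z -> ln_neg z * z <= 1.
Proof.
move=> z0; have := entropy_fun_ge0 z0; rewrite entropy_funE /ln_neg.
by case: (leP 0 (- ln z)); nra.
Qed.

(** Young's inequality with a = max(0, ln z), so that exp a = max(1, z). *)
Lemma ln_pos_mul z w : 0 <= z -> 0 <= w -> ln_pos z * w + 1 <= entropy_fun w + (1 + z).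
Proof.
move=> z0 w0; rewrite mulrC; apply: le_trans (young_entropy _ w0) _.
rewrite lerD2l /ln_pos; case: (leP 0 (ln z)) => [l0|_].
  have [->|zN0] := eqVneq z 0; first by rewrite ln0// expR0 addr0.
  by rewrite lnK ?posrE ?lt_def ?zN0// lerDr.
by rewrite expR0 lerDl.
Qed.

End entropy_function.

Lemma measurable_entropy_fun d (T : measurableType d) (R : realType) (f : T -> R) : measurable_fun setT f ->
  measurable_fun setT (fun x => entropy_fun (f x)).
Proof.
move=> mf; under eq_fun do rewrite entropy_funE.
apply: measurable_funD; last exact: measurable_cst.
apply: measurable_funB => //; apply: measurable_funM => //.
by apply: measurableT_comp => //; exact: measurable_ln.
Qed.

(** * Integral inequalities *)

Section integral_EFin.
Context d (T : measurableType d) (R : realType) (mu : {measure set T -> \bar R}).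
Local Open Scope ereal_scope.

Lemma integral_EFinD (f g : T -> R) : (forall x, 0 <= f x)%R -> (forall x, 0 <= g x)%R ->
  measurable_fun setT f -> measurable_fun setT g ->
  \int[mu]_x (f x + g x)%:E = \int[mu]_x (f x)%:E + \int[mu]_x (g x)%:E.
Proof.
move=> f0 g0 mf mg; rewrite -ge0_integralD//.
- by move=> x _; rewrite lee_fin.
- exact/measurable_EFinP.
- by move=> x _; rewrite lee_fin.
- exact/measurable_EFinP.
Qed.

Lemma integral_EFinZ (c : R) (f : T -> R) : (0 <= c)%R -> (forall x, 0 <= f x)%R ->
  measurable_fun setT f -> \int[mu]_x (c * f x)%:E = c%:E * \int[mu]_x (f x)%:E.
Proof.
move=> c0 f0 mf; under eq_integral do rewrite EFinM.
rewrite ge0_integralZl//; first exact/measurable_EFinP.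
by move=> x _; rewrite lee_fin.
Qed.

Lemma le_integral_EFin (f g : T -> R) : (forall x, 0 <= f x)%R ->
  measurable_fun setT f -> measurable_fun setT g -> (forall x, f x <= g x)%R ->
  \int[mu]_x (f x)%:E <= \int[mu]_x (g x)%:E.
Proof.
move=> f0 mf mg fg; apply: ge0_le_integral => //.
- by move=> x _; rewrite lee_fin.
- exact/measurable_EFinP.
- exact/measurable_EFinP.
- by move=> x _; rewrite lee_fin.
Qed.

Lemma integral_EFin_ge0 (f : T -> R) : (forall x, 0 <= f x)%R -> 0 <= \int[mu]_x (f x)%:E.
Proof. by move=> f0; apply: integral_ge0 => x _; rewrite lee_fin. Qed.

End integral_EFin.

Lemma integral_probability_cst d (T : measurableType d) (R : realType)
  (mu : probability T R) (c : R) : (\int[mu]_x c%:E = c%:E)%E.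
Proof. by rewrite [LHS]integral_cst// -[RHS]mule1; congr (_ * _)%E; exact: probability_setT. Qed.

Section cauchy_schwarz.
Context d (T : measurableType d) (R : realType) (mu : {measure set T -> \bar R}).
Local Open Scope ereal_scope.

(** With 0 * oo = 0 the right-hand side is meaningful, and the inequality true,
    even when one of the two norms is infinite. *)
Lemma integral_cauchy_schwarz (f g : T -> R) : (forall x, 0 <= f x)%R ->
  (forall x, 0 <= g x)%R -> measurable_fun setT f -> measurable_fun setT g ->
  \int[mu]_x (f x * g x)%:E <=
    sqrte (\int[mu]_x (f x ^+ 2)%:E) * sqrte (\int[mu]_x (g x ^+ 2)%:E).
Proof.
move=> f0 g0 mf mg.
have two0 : (0 < 2 :> R)%R by [].
have half2 : (2^-1 + 2^-1 = 1 :> R)%R by lra.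
have := hoelder mu mf mg two0 two0 half2.
have N2 (h : T -> R) : (forall x, 0 <= h x)%R ->
    ('N[mu]_2%:E[EFin \o h] = sqrte (\int[mu]_x (h x ^+ 2)%:E)).
  move=> h0; rewrite unlock poweR12_sqrt; last first.
    by apply: integral_ge0 => x _; rewrite poweR_ge0.
  congr sqrte; apply: eq_integral => x _.
  by rewrite /= powR_mulrn// ger0_norm.
rewrite !N2// Lnorm1; apply: le_trans; rewrite le_eqVlt; apply/orP; left; apply/eqP.
by apply: eq_integral => x _; rewrite /= ger0_norm// mulr_ge0.
Qed.

End cauchy_schwarz.

Section entropy_integrals.
Context d (T : measurableType d) (R : realType) (mu : probability T R).
Local Open Scope ereal_scope.

(** Young's inequality at g - L, where L is the logarithm of the integral of
    exp g, integrated against mu. *)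
Lemma entropy_variational (z g : T -> R) : (forall x, 0 <= z x)%R ->
  (forall x, 0 <= g x)%R -> measurable_fun setT z -> measurable_fun setT g ->
  \int[mu]_x (z x)%:E = 1 ->
  \int[mu]_x (g x * z x)%:E <=
    \int[mu]_x (entropy_fun (z x))%:E + lne (\int[mu]_x (expR (g x))%:E).
Proof.
move=> z0 g0 mz mg z1.
have mh := measurable_entropy_fun mz.
have h0 x : (0 <= entropy_fun (z x))%R by exact: entropy_fun_ge0.
have mexpg : measurable_fun setT (fun x => expR (g x)) by exact: measurableT_comp.
have exp0 x : (0 <= expR (g x))%R by exact: expR_ge0.
have Hge0 := integral_EFin_ge0 mu h0.
have I1 : 1 <= \int[mu]_x (expR (g x))%:E.
  rewrite -[leLHS](integral_probability_cst mu); apply: le_integral_EFin => //.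
  by move=> x; rewrite -expR0 ler_expR.
have [Ioo|Ifin] := eqVneq (\int[mu]_x (expR (g x))%:E) +oo.
  by rewrite Ioo addey ?leey// gt_eqF// (lt_le_trans _ Hge0)// ltNyr.
move: I1 Ifin; set I := \int[mu]_x (expR (g x))%:E => I1 Ifin.
have IfinN : I \is a fin_num by rewrite ge0_fin_numE ?ltey// (le_trans _ I1).
have [L [L0 lneI eLI]] : exists L : R, [/\ (0 <= L)%R, lne I = L%:E &
    (expR (- L))%:E * I = 1].
  move: I1; rewrite -(fineK IfinN); move: (fine I) => i.
  rewrite lee_fin => i1; have i0 : (0 < i)%R by exact: lt_le_trans i1.
  exists (ln i); split; [exact: ln_ge0|exact: lne_EFin|].
  by rewrite -EFinM expRN lnK ?posrE// mulVf// gt_eqF.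
have Lz0 x : (0 <= L * z x)%R by rewrite mulr_ge0.
have Lg0 x : (0 <= expR (- L) * expR (g x))%R by rewrite mulr_ge0.
have mLz : measurable_fun setT (fun x => L * z x)%R by exact: measurable_funM.
have mLg : measurable_fun setT (fun x => expR (- L) * expR (g x))%R by exact: measurable_funM.
have pt x : (g x * z x + 1 <= entropy_fun (z x) + (L * z x + expR (- L) * expR (g x)))%R.
  by have := young_entropy (g x - L) (z0 x); rewrite expRD; lra.
have gz0 x : (0 <= g x * z x)%R by rewrite mulr_ge0.
have mgz : measurable_fun setT (fun x => g x * z x)%R by exact: measurable_funM.
have := @le_integral_EFin _ _ _ mu _ _ _ _ _ pt.
have mLL : measurable_fun setT (fun x => L * z x + expR (- L) * expR (g x))%R.
  exact: measurable_funD.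
have LL0 x : (0 <= L * z x + expR (- L) * expR (g x))%R by rewrite addr_ge0.
rewrite !integral_EFinD// ?integral_EFinZ//.
rewrite integral_probability_cst z1 mule1 eLI lneI addeA leeD2rE//; apply.
- by move=> x; rewrite addr_ge0.
- exact: measurable_funD.
- exact: measurable_funD.
Qed.

Section chain_step.
Context d' (E : measurableType d') (p : T -> E).
Hypothesis mp : measurable_fun setT p.
Variables z w : T -> R.
Hypotheses (z0 : forall x, (0 <= z x)%R) (w0 : forall x, (0 <= w x)%R)
  (az : adapted p z) (mw : measurable_fun setT w) (zw : same_cond mu p w z)
  (z1 : \int[mu]_x (z x)%:E = 1).

Let mz : measurable_fun setT z. Proof. exact: (adapted_measurable mp). Qed.

(** Since z is the conditional expectation of w, the terms of entropy_chain with
    ln z have equal integrals on both sides. They are finite as soon as w has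
    finite entropy, so they cancel. *)
Lemma entropy_chain_step :
  \int[mu]_x (entropy_fun (z x))%:E + \int[mu]_x (z x * entropy_fun (w x / z x))%:E
    <= \int[mu]_x (entropy_fun (w x))%:E.
Proof.
have h0 (g : T -> R) : (forall x, 0 <= g x)%R -> forall x, (0 <= entropy_fun (g x))%R.
  by move=> g0 x; exact: entropy_fun_ge0.
have [->|Hwfin] := eqVneq (\int[mu]_x (entropy_fun (w x))%:E) +oo; first exact: leey.
have alnz : adapted p (fun x => ln (z x)) by apply: measurableT_comp => //; exact: measurable_ln.
have apos : adapted p (fun x => ln_pos (z x)).
  by apply: measurable_maxr => //; exact: measurable_cst.
have aneg : adapted p (fun x => ln_neg (z x)).
  by apply: measurable_maxr; [exact: measurable_cst|exact: measurable_funN].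
have mpos := adapted_measurable mp apos.
have mneg := adapted_measurable mp aneg.
have pos0 x : (0 <= ln_pos (z x))%R by rewrite le_max lexx.
have neg0 x : (0 <= ln_neg (z x))%R by rewrite le_max lexx.
have mquot : measurable_fun setT (fun x => z x * entropy_fun (w x / z x))%R.
  apply: measurable_funM => //; apply: measurable_entropy_fun.
  by apply: measurable_funM => //; exact: measurable_fun_inv.
have quot0 x : (0 <= z x * entropy_fun (w x / z x))%R.
  by rewrite mulr_ge0// entropy_fun_ge0// divr_ge0.
have mhw := measurable_entropy_fun mw.
have mhz := measurable_entropy_fun mz.
have posw0 x : (0 <= ln_pos (z x) * w x)%R by rewrite mulr_ge0.
have negw0 x : (0 <= ln_neg (z x) * w x)%R by rewrite mulr_ge0.
have posz0 x : (0 <= ln_pos (z x) * z x)%R by rewrite mulr_ge0.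
have negz0 x : (0 <= ln_neg (z x) * z x)%R by rewrite mulr_ge0.
have mposw : measurable_fun setT (fun x => ln_pos (z x) * w x)%R by exact: measurable_funM.
have mnegw : measurable_fun setT (fun x => ln_neg (z x) * w x)%R by exact: measurable_funM.
have mposz : measurable_fun setT (fun x => ln_pos (z x) * z x)%R by exact: measurable_funM.
have mnegz : measurable_fun setT (fun x => ln_neg (z x) * z x)%R by exact: measurable_funM.
have negfin : \int[mu]_x (ln_neg (z x) * z x)%:E \is a fin_num.
  rewrite ge0_fin_numE; last exact: integral_EFin_ge0.
  apply: (@le_lt_trans _ _ 1); last exact: ltry.
  rewrite -[leRHS](integral_probability_cst mu); apply: le_integral_EFin => //.
  by move=> x; exact: ln_neg_mul.
have pos_eq : \int[mu]_x (ln_pos (z x) * w x)%:E = \int[mu]_x (ln_pos (z x) * z x)%:E.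
  exact: (same_cond_mul mp w0 z0).
have neg_eq : \int[mu]_x (ln_neg (z x) * w x)%:E = \int[mu]_x (ln_neg (z x) * z x)%:E.
  exact: (same_cond_mul mp w0 z0).
have posfin : \int[mu]_x (ln_pos (z x) * z x)%:E \is a fin_num.
  rewrite -pos_eq ge0_fin_numE; last exact: integral_EFin_ge0.
  apply: (@le_lt_trans _ _ (\int[mu]_x (entropy_fun (w x) + (1 + z x))%:E)).
    apply: le_integral_EFin => //.
      by apply: measurable_funD => //; exact: measurable_funD.
    by move=> x; rewrite (le_trans _ (ln_pos_mul (z0 x) (w0 x)))// lerDl.
  rewrite !integral_EFinD//; last 3 first.
  - exact: h0.
  - by move=> x; rewrite addr_ge0.
  - exact: measurable_funD.
  by rewrite integral_probability_cst z1 lte_add_pinfty ?ltey.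
have : \int[mu]_x (entropy_fun (w x) + (ln_neg (z x) * w x + ln_pos (z x) * z x))%:E =
  \int[mu]_x ((entropy_fun (z x) + z x * entropy_fun (w x / z x)) +
    (ln_pos (z x) * w x + ln_neg (z x) * z x))%:E.
  apply: ge0_ae_eq_integral => //.
  - apply/measurable_EFinP; apply: measurable_funD => //; exact: measurable_funD.
  - by apply/measurable_EFinP; apply: measurable_funD; exact: measurable_funD.
  - by move=> x _; rewrite lee_fin addr_ge0 ?h0// addr_ge0.
  - by move=> x _; rewrite lee_fin addr_ge0// addr_ge0// h0.
  by apply: filterS (same_cond_null mp w0 mw az zw) => x zw0 _; rewrite entropy_chain.
rewrite !integral_EFinD//; do ?[exact: h0|by move=> x; rewrite addr_ge0// h0|exact: measurable_funD].
rewrite neg_eq pos_eq [X in _ = _ + X -> _]addeC => eqH.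
rewrite le_eqVlt; apply/orP; left; apply/eqP; apply/esym.
by apply: addeIr eqH; rewrite fin_numD negfin.
Qed.

End chain_step.

End entropy_integrals.

(** * Bounding the cost by the entropy *)

Lemma sqr_sum_le (R : realDomainType) (a : nat -> R) n :
  (\sum_(0 <= s < n) a s) ^+ 2 <= n%:R * \sum_(0 <= s < n) a s ^+ 2.
Proof.
have amgm b m : 2 * (\sum_(0 <= s < m) a s) * b <= \sum_(0 <= s < m) a s ^+ 2 + m%:R * b ^+ 2.
  elim: m => [|m IH]; first by rewrite !big_nil mulr0 !mul0r addr0.
  rewrite !big_nat_recr//= -natr1.
  have := sqr_ge0 (a m - b); lra.
elim: n => [|n IH]; first by rewrite !big_nil expr0n mul0r.
rewrite !big_nat_recr//= -natr1.
have := amgm (a n) n; lra.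
Qed.

Section overlap_entropy.
Context (R : realType) d (T : measurableType d) (dE : nat -> measure_display)
  (E : forall t, measurableType (dE t)).
Variables (mu : probability T R) (p : forall t, T -> E t) (N : nat).
Hypothesis mp : forall t, measurable_fun setT (p t).
Hypothesis p_mono : forall s t, (s <= t)%N ->
  g_sigma_algebra_preimage (p s) `<=` g_sigma_algebra_preimage (p t).
Variable f : T -> R.
Hypotheses (f0 : forall x, 0 <= f x) (mf : measurable_fun setT f)
  (f1 : (\int[mu]_x (f x)%:E = 1)%E).
Variable Z : nat -> T -> R.
Hypotheses (Z0 : forall t x, 0 <= Z t x) (aZ : forall t, adapted (p t) (Z t))
  (Zf : forall t, same_cond mu (p t) f (Z t)) (Z01 : forall x, Z 0%N x = 1)
  (ZN : Z N = f).

Let step s x := Z s x * entropy_fun (Z s.+1 x / Z s x).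

Let step0 s x : 0 <= step s x.
Proof. by rewrite mulr_ge0// entropy_fun_ge0// divr_ge0. Qed.

Let mZ t : measurable_fun setT (Z t).
Proof. exact: (adapted_measurable (@mp t) (@aZ t)). Qed.

Let mstep s : measurable_fun setT (step s).
Proof.
apply: measurable_funM => //; apply: measurable_entropy_fun.
by apply: measurable_funM => //; exact: measurable_fun_inv.
Qed.

(** The loss of overlap is M (1 - r) with r < 1; its square is at most
    M ^ 2 times 2 h(r), h being entropy_fun, and M ^ 2 <= Z because M is at most
    both 1 and Z. *)
Lemma overlap_step s x :
  (overlap Z s x - overlap Z s.+1 x) ^+ 2 <= 2 * (Z s x * entropy_fun (Z s.+1 x / Z s x)).
Proof.
have M0 := overlap_ge0 Z0 s x; have M1 := overlap_le1 Z0 s x.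
have MZ := overlap_le_density Z0 Z01 s x.
have r0 : 0 <= Z s.+1 x / Z s x by rewrite divr_ge0.
have := step0 s x; rewrite /step /=.
move: (overlap Z s x) (Z s x) (Z s.+1 x / _) M0 M1 MZ r0 => M z r M0 M1 MZ r0 st0.
case: (leP 1 r) => [_|r1]; first by rewrite mulr1 subrr expr0n mulr_ge0.
have q := entropy_fun_quad_le1 (r := r).
have {}q : (1 - r) ^+ 2 <= 2 * entropy_fun r by apply: q; rewrite r0 ltW.
have -> : (M - M * r) ^+ 2 = (M * M) * (1 - r) ^+ 2 by ring.
rewrite [leRHS]mulrCA; apply: ler_pM => //; [exact: mulr_ge0|exact: sqr_ge0|].
by apply: le_trans MZ; rewrite ler_piMr.
Qed.

Local Open Scope ereal_scope.

(** The conditional entropies of the steps add up to at most the entropy of the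
    prefix of length n. *)
Lemma entropy_chain_rule n :
  \sum_(0 <= s < n) \int[mu]_x (Z s x * entropy_fun (Z s.+1 x / Z s x))%:E
    <= \int[mu]_x (entropy_fun (Z n x))%:E.
Proof.
elim: n => [|n IH].
  by rewrite big_nil; apply: integral_EFin_ge0 => x; exact: entropy_fun_ge0.
rewrite big_nat_recr//=; apply: (le_trans (leeD2r _ IH)).
apply: (entropy_chain_step (@mp n)) => //.
- move=> C FC; transitivity (\int[mu]_(x in C) (f x)%:E); last exact: Zf.
  by apply/esym/Zf; exact: (p_mono (leqnSn n)).
- rewrite -Zf//; exists setT => //; by rewrite preimage_setT setTI.
Qed.

(** 1 - M is the sum of the losses over the steps. Cauchy-Schwarz over the N steps
    produces the factor N, hence the square root in the final bound. *)
Lemma overlap_entropy : \int[mu]_x ((1 - overlap Z N x) ^+ 2)%:E <=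
  N%:R%:E * (2%:E * \int[mu]_x (entropy_fun (f x))%:E).
Proof.
have mM t : measurable_fun setT (overlap Z t).
  exact: (adapted_measurable (@mp t) (overlap_adapted p_mono Z0 aZ (t := t))).
apply: (@le_trans _ _ (\int[mu]_x (N%:R * \sum_(0 <= s < N) (2 * step s x))%:E)).
  apply: le_integral_EFin => [x| | |x].
  - exact: sqr_ge0.
  - by apply: measurable_funX; exact: measurable_funB.
  - apply: measurable_funM => //; apply: measurable_sum => s.
    by apply: measurable_funM.
  - apply: (@le_trans _ _ (N%:R * \sum_(0 <= s < N) (overlap Z s x - overlap Z s.+1 x) ^+ 2)%R).
      have := sqr_sum_le (fun s => overlap Z s x - overlap Z s.+1 x)%R N.
      rewrite (@telescope_sumr_eq _ _ _ (fun s => - overlap Z s x)%R)//.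
        by rewrite addrC opprK.
      by move=> s _; rewrite addrC opprK.
    by rewrite ler_wpM2l// ler_sum// => s _; exact: overlap_step.
rewrite integral_EFinZ//; last 2 first.
- by move=> x; apply: sumr_ge0 => s _; rewrite mulr_ge0.
- by apply: measurable_sum => s; exact: measurable_funM.
rewrite lee_wpmul2l// ?lee_fin//.
under eq_integral do rewrite -mulr_sumr.
rewrite integral_EFinZ//; last 2 first.
- by move=> x; apply: sumr_ge0 => s _.
- exact: measurable_sum.
rewrite lee_wpmul2l// ?lee_fin//.
under eq_integral do rewrite -sumEFin.
rewrite ge0_integral_sum//; last 2 first.
- by move=> s; exact/measurable_EFinP.
- by move=> s x _; rewrite lee_fin.
by rewrite -ZN; exact: entropy_chain_rule.
Qed.

Variable phi : T -> R.
Hypotheses (phi0 : forall x, (0 <= phi x)%R) (mphi : measurable_fun setT phi).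

Let H := \int[mu]_x (entropy_fun (f x))%:E.
Let L := lne (\int[mu]_x (expR (phi x ^+ 2))%:E).

Let H0 : 0 <= H. Proof. by apply: integral_EFin_ge0 => x; exact: entropy_fun_ge0. Qed.

Let L0 : 0 <= L.
Proof.
rewrite lne_ge0 -[leLHS](integral_probability_cst mu).
apply: le_integral_EFin => //.
- by apply: measurableT_comp => //; exact: measurable_funX.
- by move=> x; rewrite -[leLHS]expR0 ler_expR sqr_ge0.
Qed.

Let HL0 : 0 <= H + L. Proof. exact: adde_ge0. Qed.

Let L10 : 0 <= 1 + L. Proof. exact: adde_ge0. Qed.

Let H20 : 0 <= 2%:E * H. Proof. by rewrite mule_ge0// lee_fin. Qed.

Let mphi2 : measurable_fun setT (fun x => phi x ^+ 2)%R.
Proof. exact: measurable_funX. Qed.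

(** The variational inequality for the constant density 1, whose entropy is 0. *)
Lemma weight_mass : \int[mu]_x (phi x ^+ 2)%:E <= L.
Proof.
have one1 : \int[mu]_x (cst 1 x : R)%:E = 1 by exact: integral_probability_cst.
have sq0 x : (0 <= phi x ^+ 2)%R by exact: sqr_ge0.
have one0 (x : T) : (0 <= cst 1 x :> R)%R by [].
have := entropy_variational one0 sq0 (measurable_cst _) mphi2 one1.
rewrite (_ : \int[mu]_x (entropy_fun (cst 1 x))%:E = 0) ?add0e; last first.
  by apply: integral0_eq => x _; rewrite /= entropy_fun1.
by under eq_integral do rewrite mulr1.
Qed.

Lemma weight_mass_density : \int[mu]_x (phi x ^+ 2 * f x)%:E <= H + L.
Proof. by apply: entropy_variational => // x; exact: sqr_ge0. Qed.

Lemma overlap_loss : \int[mu]_x (phi x * (1 - overlap Z N x))%:E <=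
  sqrte (1 + L) * ((Num.sqrt N%:R)%:E * sqrte (2%:E * H)).
Proof.
have M1 x : (0 <= 1 - overlap Z N x)%R by rewrite subr_ge0 overlap_le1.
have mM : measurable_fun setT (fun x => 1 - overlap Z N x)%R.
  apply: measurable_funB => //.
  exact: (adapted_measurable (@mp N) (overlap_adapted p_mono Z0 aZ (t := N))).
apply: (le_trans (integral_cauchy_schwarz mu phi0 M1 mphi mM)).
apply: lee_pmul; rewrite ?sqrte_ge0//.
  rewrite (lee_sqrt _ L10); apply: (le_trans weight_mass).
  by rewrite leeDr.
rewrite -[(Num.sqrt _)%:E]/(sqrte N%:R%:E) -sqrteM ?lee_fin//.
by rewrite lee_sqrt; [exact: overlap_entropy|rewrite mule_ge0// lee_fin].
Qed.

Let excess x := Num.max 0%R (f x - 1)%R.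

Let excess0 x : (0 <= excess x)%R. Proof. by rewrite le_max lexx. Qed.

Let mexcess : measurable_fun setT excess.
Proof. by apply: measurable_maxr => //; exact: measurable_funB. Qed.

Let sqrtf0 x : (0 <= Num.sqrt (f x))%R. Proof. exact: sqrtr_ge0. Qed.

Let msqrtf : measurable_fun setT (fun x => Num.sqrt (f x)).
Proof.
exact: (measurableT_comp (continuous_measurable_fun (@sqrt_continuous R)) mf).
Qed.

(** Cauchy-Schwarz for the measure with density f. *)
Let root_mass (g : T -> R) : (forall x, 0 <= g x)%R -> measurable_fun setT g ->
  \int[mu]_x (phi x * Num.sqrt (f x) * g x)%:E <=
  sqrte (H + L) * sqrte (\int[mu]_x (g x ^+ 2)%:E).
Proof.
move=> g0 mg; have u0 x : (0 <= phi x * Num.sqrt (f x))%R by rewrite mulr_ge0.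
have mu_ : measurable_fun setT (fun x => phi x * Num.sqrt (f x))%R.
  exact: measurable_funM.
apply: (le_trans (integral_cauchy_schwarz mu u0 g0 mu_ mg)).
apply: lee_wpmul2r; first exact: sqrte_ge0.
rewrite (lee_sqrt _ HL0).
apply: le_trans weight_mass_density; rewrite le_eqVlt; apply/orP; left; apply/eqP.
by apply: eq_integral => x _; rewrite exprMn sqr_sqrtr.
Qed.

(** If H <= 1, the excess is at most sqrt (2 h(f)) sqrt f pointwise, and the integral of
    phi ^ 2 f is at most H + L <= 1 + L. If H > 1, bounding the excess by f is enough,
    as H + L <= 2 H (1 + L). *)
Lemma excess_loss : \int[mu]_x (phi x * Num.max 0 (f x - 1))%:E <=
  sqrte (1 + L) * sqrte (2%:E * H).
Proof.
have [H1|H1] := leP H 1.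
  (* Where f = 0 the excess is 0 as well, and so is the quotient *)
  pose g x := (excess x / Num.sqrt (f x))%R.
  have g0 x : (0 <= g x)%R by rewrite divr_ge0.
  have mg : measurable_fun setT g by apply: measurable_funM => //; exact: measurable_fun_inv.
  apply: (@le_trans _ _ (\int[mu]_x (phi x * Num.sqrt (f x) * g x)%:E)).
    rewrite le_eqVlt; apply/orP; left; apply/eqP; apply: eq_integral => x _.
    rewrite /g -/(excess x); congr EFin.
    have [fx0|fx0] := eqVneq (f x) 0%R.
      by rewrite /excess fx0 sub0r max_l ?lerN10// mulr0 mul0r mulr0.
    by rewrite -[RHS]mulrA [(Num.sqrt _ * _)%R]mulrC divfK// sqrtr_eq0 -ltNge lt_def fx0/=.
  apply: le_trans (root_mass g0 mg) _.
  apply: lee_pmul; rewrite ?sqrte_ge0//; first by rewrite (lee_sqrt _ L10); exact: leeD2r.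
  rewrite (lee_sqrt _ H20).
  rewrite -integral_EFinZ//; last 2 first.
  - by move=> x; exact: entropy_fun_ge0.
  - exact: measurable_entropy_fun.
  apply: le_integral_EFin => [x| | |x].
  - exact: sqr_ge0.
  - exact: measurable_funX.
  - by apply: measurable_funM => //; exact: measurable_entropy_fun.
  rewrite /g /excess; case: (leP 0%R (f x - 1)%R) => f1x; last first.
    by rewrite mul0r expr0n mulr_ge0// entropy_fun_ge0.
  have {}f1x : (1 <= f x)%R by rewrite -subr_ge0.
  rewrite exprMn exprVn sqr_sqrtr// ler_pdivrMr ?(lt_le_trans ltr01)//.
  by rewrite -mulrA [(entropy_fun _ * _)%R]mulrC mulrA; exact: entropy_fun_quad_ge1.
apply: (@le_trans _ _ (\int[mu]_x (phi x * Num.sqrt (f x) * Num.sqrt (f x))%:E)).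
  apply: le_integral_EFin => [x| | |x].
  - exact: mulr_ge0 (phi0 x) (excess0 x).
  - exact: measurable_funM mphi mexcess.
  - by apply: measurable_funM => //; exact: measurable_funM.
  by rewrite -mulrA -expr2 sqr_sqrtr// ler_wpM2l// ge_max f0/= gerBl.
apply: le_trans (root_mass sqrtf0 msqrtf) _.
under eq_integral do rewrite sqr_sqrtr//.
have sqrte1 : sqrte (1 : \bar R) = 1 by rewrite /= sqrtr1.
rewrite f1 sqrte1 mule1 -sqrteM//.
rewrite lee_sqrt ?mule_ge0// ge0_muleDl// mul1e.
have H2 : H <= 2%:E * H by rewrite lee_pemull// lee_fin ler1n.
rewrite leeD// lee_pemulr//.
by rewrite (le_trans (ltW H1)).
Qed.

(** 1 + f - 2 M = 2 (1 - M) + (f - 1), so the loss 1 - M counts twice and the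
    excess of f over 1 once: this is the constant 2 sqrt N + 1. *)
Lemma overlap_cost : \int[mu]_x (phi x * (1 + f x - 2 * overlap Z N x))%:E <=
  (2 * Num.sqrt N%:R + 1)%:E * sqrte (1 + L) * sqrte (2%:E * H).
Proof.
have M1 x : (0 <= 1 - overlap Z N x)%R by rewrite subr_ge0 overlap_le1.
have mM : measurable_fun setT (overlap Z N).
  exact: (adapted_measurable (@mp N) (overlap_adapted p_mono Z0 aZ (t := N))).
have phiM0 x : (0 <= phi x * (1 - overlap Z N x))%R by rewrite mulr_ge0.
have phie0 x : (0 <= phi x * Num.max 0 (f x - 1))%R by rewrite mulr_ge0// excess0.
have mphiM : measurable_fun setT (fun x => phi x * (1 - overlap Z N x))%R.
  by apply: measurable_funM => //; exact: measurable_funB.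
have mphie : measurable_fun setT (fun x => phi x * Num.max 0 (f x - 1))%R.
  exact: measurable_funM.
apply: (@le_trans _ _ (\int[mu]_x (2 * (phi x * (1 - overlap Z N x))
    + phi x * Num.max 0 (f x - 1))%:E)).
  apply: le_integral_EFin => [x| | |x].
  - rewrite mulr_ge0//; have := overlap_le_density Z0 Z01 N x; rewrite ZN.
    have := M1 x; lra.
  - apply: measurable_funM => //; apply: measurable_funB; last exact: measurable_funM.
    exact: measurable_funD.
  - apply: measurable_funD => //; exact: measurable_funM.
  - rewrite mulrCA -mulrDr ler_wpM2l//.
    have : (f x - 1 <= Num.max 0 (f x - 1))%R by rewrite le_max lexx orbT.
    lra.
rewrite integral_EFinD//; last 2 first.
- by move=> x; rewrite mulr_ge0.
- exact: measurable_funM.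
rewrite integral_EFinZ//.
apply: (@le_trans _ _ (2%:E * (sqrte (1 + L) * ((Num.sqrt N%:R)%:E * sqrte (2%:E * H))) +
   sqrte (1 + L) * sqrte (2%:E * H))).
  apply: leeD; last exact: excess_loss.
  by rewrite lee_wpmul2l ?lee_fin//; exact: overlap_loss.
have sq0 (x : \bar R) : 0 <= sqrte x by exact: sqrte_ge0.
have -> : (2 * Num.sqrt N%:R + 1)%:E = 2%:E * (Num.sqrt N%:R)%:E + 1 :> \bar R by [].
rewrite -[leRHS]muleA ge0_muleDl ?lee_fin ?mule_ge0 ?lee_fin ?sqrtr_ge0// mul1e.
by rewrite [sqrte (1 + L) * (_%:E * _)]muleCA !muleA.
Qed.

End overlap_entropy.

(** * Relative entropy as the entropy of a density *)

Section entropy_density.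
Context d (T : measurableType d) (R : realType) (mu nu : probability T R).
Local Open Scope ereal_scope.

(** Integrating ln f against nu = f mu gives E[f ln f], and the remaining part
    1 - f of entropy_fun f has integral 0. The negative part of f ln f is at most
    1, so the difference of integrals is well defined. *)
Lemma relative_entropy_density : nu `<< mu -> exists f : T -> R,
  [/\ forall x, (0 <= f x)%R, measurable_fun setT f,
      forall A, measurable A -> nu A = \int[mu]_(x in A) (f x)%:E &
      \int[mu]_x (entropy_fun (f x))%:E <= relative_entropy nu mu].
Proof.
move=> numu; pose F := Radon_Nikodym_SigmaFinite.f nu mu.
have F0 x : 0 <= F x by exact: Radon_Nikodym_SigmaFinite.f_ge0.
have Ffin x : F x \is a fin_num by exact: Radon_Nikodym_SigmaFinite.f_fin_num.
have mF : measurable_fun setT F.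
  exact: measurable_int (Radon_Nikodym_SigmaFinite.f_integrable numu).
pose f x := fine (F x).
have fE x : (f x)%:E = F x by rewrite fineK.
have f0 x : (0 <= f x)%R by exact: fine_ge0.
have mf : measurable_fun setT f by exact: measurableT_comp.
have nuE A : measurable A -> nu A = \int[mu]_(x in A) (f x)%:E.
  move=> mA; rewrite (Radon_Nikodym_SigmaFinite.f_integral numu mA).
  by apply: eq_integral => x _; rewrite fE.
exists f; split => //.
have f1 : \int[mu]_x (f x)%:E = 1 by rewrite -nuE//; exact: probability_setT.
have nuint (g : T -> R) : (forall x, 0 <= g x)%R -> measurable_fun setT g ->
    \int[nu]_x (g x)%:E = \int[mu]_x (g x * f x)%:E.
  move=> g0 mg; have [m [mE mint]] := density_exists mu f0 mf.
  transitivity (\int[m]_x (g x)%:E).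
    by apply: eq_measure_integral => A mA _; rewrite mE; exact: nuE.
  by rewrite mint//; exact/measurable_EFinP.
have f_null : nu [set x | f x = 0%R] = 0.
  rewrite nuE; first by apply: integral0_eq => x /= ->.
  by have := mf measurableT _ (measurable_set1 0%R); rewrite setTI.
set g := Radon_Nikodym (charge_of_finite_measure nu) mu.
have mg : measurable_fun setT g by apply: measurable_int; exact: Radon_Nikodym_integrable.
have gfin x : g x \is a fin_num by exact: Radon_Nikodym_fin_num.
have fg : {ae nu, forall x, lne (g x) = (ln (f x))%:E}.
  have [B [mB B0 gB]] : {ae mu, forall x, setT x -> F x = g x}.
    exact: ae_eq_Radon_Nikodym_SigmaFinite.
  exists (B `|` [set x | f x = 0%R]); split.
  - apply: measurableU => //.
    by have := mf measurableT _ (measurable_set1 0%R); rewrite setTI.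
  - apply/eqP; rewrite eq_le measure_ge0 andbT.
    rewrite (le_trans (measureU2 _ _ _))//.
      by have := mf measurableT _ (measurable_set1 0%R); rewrite setTI.
    have /null_content_dominatesP := numu; move=> /(_ B mB B0) => nuB.
    by rewrite [X in _ + X]f_null [X in X + _]nuB adde0.
  move=> x /= nx; apply: contrapT => /not_orP[nB fx0]; apply: nx.
  have gx : F x = g x.
    by apply: contrapT => ne; apply: nB; apply: gB => /(_ Logic.I).
  rewrite -gx -fE lne_EFin// lt_def f0 andbT.
  exact/eqP.
have mlnf : measurable_fun setT (fun x => ln (f x)).
  by apply: measurableT_comp => //; exact: measurable_ln.
have mlneg : measurable_fun setT (fun x => lne (g x)).
  rewrite (_ : (fun _ => _) = fun x => if (fine (g x) <= 0)%R then -oo else (ln (fine (g x)))%:E).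
    have mfg : measurable_fun setT (fun x => fine (g x)) by exact: measurableT_comp.
    apply: measurable_fun_ifT => //.
      by apply: measurable_fun_ler.
    by apply/measurable_EFinP; apply: measurableT_comp => //; exact: measurable_ln.
  by apply/funext => x; rewrite -[in LHS](fineK (gfin x)).
rewrite /relative_entropy; case: pselect => //= _; rewrite -/g.
rewrite [leRHS](ae_eq_integral (fun x => (ln (f x))%:E))//; last 2 first.
- exact/measurable_EFinP.
- by apply: filterS fg => x + _.
rewrite integralE.
have mpos : measurable_fun setT (fun x => ln_pos (f x)) by exact: measurable_maxr.
have mneg : measurable_fun setT (fun x => ln_neg (f x)).
  by apply: measurable_maxr => //; exact: measurable_funN.
have pos0 x : (0 <= ln_pos (f x))%R by rewrite le_max lexx.
have neg0 x : (0 <= ln_neg (f x))%R by rewrite le_max lexx.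
have -> : \int[nu]_x ((fun x => (ln (f x))%:E)^\+ x) = \int[mu]_x (ln_pos (f x) * f x)%:E.
  by rewrite -nuint//; apply: eq_integral => x _; rewrite funeposE /ln_pos maxC EFin_max.
have -> : \int[nu]_x ((fun x => (ln (f x))%:E)^\- x) = \int[mu]_x (ln_neg (f x) * f x)%:E.
  by rewrite -nuint//; apply: eq_integral => x _; rewrite funenegE /ln_neg maxC EFin_max.
have negfin : \int[mu]_x (ln_neg (f x) * f x)%:E \is a fin_num.
  rewrite ge0_fin_numE; last by apply: integral_EFin_ge0 => x; rewrite mulr_ge0.
  apply: (@le_lt_trans _ _ 1); last exact: ltry.
  rewrite -[leRHS](integral_probability_cst mu); apply: le_integral_EFin => //.
  - by move=> x; rewrite mulr_ge0.
  - exact: measurable_funM.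
  - by move=> x; exact: ln_neg_mul.
rewrite leeBrDr// -(leeD2rE _ _ (_ : 1 \is a fin_num))//.
rewrite -[X in _ + X <= _]f1 -[X in _ <= _ + X](integral_probability_cst mu).
have hf0 x : (0 <= entropy_fun (f x))%R by exact: entropy_fun_ge0.
have mhf := measurable_entropy_fun mf.
have posf0 x : (0 <= ln_pos (f x) * f x)%R by rewrite mulr_ge0.
have negf0 x : (0 <= ln_neg (f x) * f x)%R by rewrite mulr_ge0.
have mposf : measurable_fun setT (fun x => ln_pos (f x) * f x)%R by exact: measurable_funM.
have mnegf : measurable_fun setT (fun x => ln_neg (f x) * f x)%R by exact: measurable_funM.
have hn0 x : (0 <= entropy_fun (f x) + ln_neg (f x) * f x)%R by rewrite addr_ge0.
have mhn : measurable_fun setT (fun x => entropy_fun (f x) + ln_neg (f x) * f x)%R.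
  exact: measurable_funD.
rewrite -!integral_EFinD//; apply: le_integral_EFin => [x| | |x].
- by rewrite addr_ge0.
- exact: measurable_funD.
- exact: measurable_funD.
- by rewrite entropy_funE -[ln (f x)]ln_posneg; lra.
Qed.

End entropy_density.

(** * Prefixes and the main inequality *)

Lemma continuous_to_product (S : topologicalType) (I : finType) (X : I -> ptopologicalType)
    (f : S -> product_space X) : (forall i, continuous (fun x => f x i)) -> continuous f.
Proof.
move=> cf x U /nbhs_product[V [xV VU]].
have : nbhs x [set y | forall i, V i (f y i)].
  by apply: (@filter_forall _ _ (fun i y => V i (f y i)) (nbhs x)) => i; exact: cf (xV i).
by apply: filterS => y /VU.
Qed.

Section prefixes.
Context (T : nat) (X : 'I_T -> ptopologicalType).

Definition prefix_map t : borel (product_space X) -> borel (prefix_space X t) := first_coords t.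
Arguments prefix_map : clear implicits.

Lemma measurable_prefix_map t : measurable_fun setT (prefix_map t).
Proof.
apply: continuous_borel_measurable.
by apply: continuous_to_product => i; exact: coord_continuous.
Qed.

Lemma prefix_map_mono s t : (s <= t)%N ->
  g_sigma_algebra_preimage (prefix_map s) `<=` g_sigma_algebra_preimage (prefix_map t).
Proof.
move=> st _ [B mB <-].
pose r (y : borel (prefix_space X t)) : borel (prefix_space X s) :=
  fun i => y (exist _ (sval i) (leq_trans (svalP i) st)).
have mr : measurable_fun setT r.
  apply: continuous_borel_measurable.
  apply: continuous_to_product => i.
  exact: (@coord_continuous _ (fun i : {i : 'I_T | (i < t)%N} => X (sval i))
    (exist _ (sval i) (leq_trans (svalP i) st))).
by exists (r @^-1` B) => //; rewrite -[_ @^-1` B]setTI; exact: mr.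
Qed.

(** The empty prefix carries no information: its space has a single point. *)
Lemma prefix_map0 C : g_sigma_algebra_preimage (prefix_map 0) C -> C = set0 \/ C = setT.
Proof.
move=> [B mB <-]; rewrite setTI.
have [[x Bx]|B0] := pselect (exists x, B (prefix_map 0 x)); [right|left].
  apply/seteqP; split => // y _ /=.
  have -> : prefix_map 0 y = prefix_map 0 x by apply: functional_extensionality_dep => -[].
  exact: Bx.
by apply/seteqP; split => // y By; apply: B0; exists y.
Qed.

(** All coordinates together have a continuous left inverse. *)
Lemma prefix_map_full C : measurable C -> g_sigma_algebra_preimage (prefix_map T) C.
Proof.
move=> mC.
pose r (y : borel (prefix_space X T)) : borel (product_space X) :=
  fun i => y (exist _ i (ltn_ord i)).
have mr : measurable_fun setT r.
  apply: continuous_borel_measurable.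
  apply: continuous_to_product => i.
  exact: (@coord_continuous _ (fun i : {i : 'I_T | (i < T)%N} => X (sval i))
    (exist _ i (ltn_ord i))).
by exists (r @^-1` C); [rewrite -[_ @^-1` C]setTI; exact: mr|rewrite setTI].
Qed.

End prefixes.

Local Open Scope ereal_scope.

Theorem theorem7 (R : realType) (T : nat) (T_ge1 : (1 <= T)%N)
    (X : 'I_T -> ptopologicalType) (polishX : forall t, polish R (X t))
    (mu nu : probability (borel (product_space X)) R)
    (phi : borel (product_space X) -> R) (phi_ge0 : forall x, (0 <= phi x)%R)
    (mphi : measurable_fun setT phi) :
  ATV phi mu nu <=
    (2 * Num.sqrt T%:R + 1)%:E
    * (1 + lne (\int[mu]_x (expR (phi x ^+ 2))%:E)) `^ 2^-1
    * sqrte (2%:E * relative_entropy nu mu).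
Proof.
set L := lne _.
have L0 : 0 <= L.
  rewrite lne_ge0 -[leLHS](integral_probability_cst mu); apply: le_integral_EFin => //.
  - by apply: measurableT_comp => //; exact: measurable_funX.
  - by move=> x; rewrite -[leLHS]expR0 ler_expR sqr_ge0.
have L10 : 0 <= 1 + L by exact: adde_ge0.
rewrite poweR12_sqrt//.
(* Without a density the right-hand side is infinite, since its other factors are positive *)
have [numu|Nnumu] := pselect (nu `<< mu); last first.
  rewrite /relative_entropy; case: pselect => //= _.
  rewrite gt0_muley ?lte_fin//= gt0_muley ?leey// mule_gt0//.
  apply: (@lt_le_trans _ _ (sqrte 1)); first by rewrite /= sqrtr1.
  by rewrite lee_sqrt// leeDl.
have [f [f0 mf nu_f fH]] := relative_entropy_density numu.
have f1 : \int[mu]_x (f x)%:E = 1 by rewrite -nu_f//; exact: probability_setT.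
have exOC i : exists OC : (nat * nat -> set (X i)) * (nat * nat -> set (X i)),
    regular_base OC.1 OC.2.
  by have [U [V UV]] := polish_regular_base (polishX i); exists (U, V).
have base := product_regular_base (fun i => svalP (cid (exOC i))).
have X_hausdorff : hausdorff_space (product_space X).
  apply: hausdorff_product => i.
  have [_ [d [[d0 d_eq0 d_sym d_tri] [d_nbhs _]]]] := polishX i.
  exact: (metrizable_hausdorff d0 d_eq0 d_sym d_tri d_nbhs).
have mu_radon : radon mu.
  by apply: (tight_radon base X_hausdorff) => e e0; exact: product_tight.
have rect_open := open_rectangles base.
have [Z [Z0 aZ Zf Z01 ZN]] := density_process_exists (@measurable_prefix_map T X)
  (@prefix_map0 T X) (@prefix_map_full T X) T_ge1 f0 mf f1.
have [pi [pi1 pi2 causal cost]] := adapted_coupling_exists (@measurable_prefix_map T X)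
  (@prefix_map_mono T X) mu_radon rect_open X_hausdorff f0 mf nu_f Z0 aZ Zf Z01 ZN.
apply: le_trans (ereal_inf_lbound _) _.
  exists pi; last by [].
  by split=> // t /andP[_ tT]; exact: causal (ltnW tT).
apply: le_trans (cost phi phi_ge0 mphi) _.
apply: le_trans (overlap_cost (@measurable_prefix_map T X) (@prefix_map_mono T X)
  f0 mf f1 Z0 aZ Zf Z01 ZN phi_ge0 mphi) _.
apply: lee_wpmul2l.
  by rewrite mule_ge0 ?sqrte_ge0// lee_fin addr_ge0 ?mulr_ge0 ?sqrtr_ge0.
have H0 : 0 <= \int[mu]_x (entropy_fun (f x))%:E.
  by apply: integral_EFin_ge0 => x; exact: entropy_fun_ge0.
rewrite lee_sqrt; last by rewrite mule_ge0 ?lee_fin// (le_trans H0).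
by rewrite lee_wpmul2l ?lee_fin.
Qed.
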